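(* Let $n\ge 1$, $0\le k\le n/2$, and let $\sigma,\sigma'\in \mathbf S_n^2(k)$ be such that $\sigma'\prec\sigma$. Then $$\operatorname{codim}_{\overline{\mathcal B}_\sigma}\mathcal B_{\sigma'}=1\quad\text{if and only if}\quad \sigma'\in D(\sigma).$$
   Context: Work over $\mathbb C$. $\mathbf B\subset GL_n$ is the group of invertible upper-triangular $n\times n$ matrices, acting by conjugation on the space $\mathfrak n$ of strictly upper-triangular $n\times n$ matrices. $\mathbf S_n^2=\{\sigma\in \mathbf S_n:\sigma^2=\mathrm{Id}\}$ (including $\mathrm{Id}$), and $\mathbf S_n^2(k)$ is the subset of those $\sigma$ that are products of exactly $k$ disjoint 2-cycles. For $\sigma\in\mathbf S_n^2$, $N_\sigma\in\mathfrak n$ is the matrix with $(N_\sigma)_{i,j}=1$ if $i<j$ and $\sigma(i)=j$, and $(N_\sigma)_{i,j}=0$ otherwise. $\mathcal B_\sigma=\{bN_\sigma b^{-1}: b\in\mathbf B\}$ is its $\mathbf B$-orbit, and $\overline{\mathcal B}_\sigma$ is its Zariski closure. Rank matrix: $R_\sigma$ is the $n\times n$ matrix with $(R_\sigma)_{i,j}=0$ for $i\ge j$ and, for $i<j$, $(R_\sigma)_{i,j}$ equal to the rank of the submatrix of $N_\sigma$ with rows and columns $i,i+1,\dots,j$ (equivalently the number of 2-cycles of $\sigma$ with both entries in $\{i,\dots,j\}$). Partial order on $\mathbf S_n^2$: $\sigma'\preceq\sigma$ if $(R_{\sigma'})_{i,j}\le (R_\sigma)_{i,j}$ for all $i,j$;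 $\sigma'\prec\sigma$ means $\sigma'\preceq\sigma$ and $\sigma'\neq\sigma$. (It is known that $\sigma'\preceq\sigma$ iff $\mathcal B_{\sigma'}\subseteq\overline{\mathcal B}_\sigma$.) Descendants: for $\sigma\in\mathbf S_n^2(k)$, $D(\sigma)$ is the set of all $\sigma'\in\mathbf S_n^2(k)$ such that $\sigma'\prec\sigma$ and such that every $\sigma''$ with $\sigma'\preceq\sigma''\preceq\sigma$ satisfies $\sigma''=\sigma$ or $\sigma''=\sigma'$ (any such $\sigma''$ automatically lies in $\mathbf S_n^2(k)$). $\operatorname{codim}_{\overline{\mathcal B}_\sigma}\mathcal B_{\sigma'}=\dim\mathcal B_\sigma-\dim\mathcal B_{\sigma'}$. *)

(* Defs.v *)
From mathcomp Require Import all_boot all_order all_algebra all_fingroup.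
From mathcomp Require Import boolp classical_sets reals.
From mathcomp Require Import complex mpoly.

Set Implicit Arguments.
Unset Strict Implicit.
Unset Printing Implicit Defensive.

Import GRing.Theory.
Local Open Scope ring_scope.

Definition S2 (n : nat) : {set 'S_n} := [set s : 'S_n | (s * s)%g == 1%g].

Definition S2k (n k : nat) : {set 'S_n} :=
  [set s in S2 n | #|[set c in porbits s | #|c| == 2%N]| == k].

Section Zariski.
Local Open Scope classical_set_scope.
Variables (K : fieldType) (n : nat).
Implicit Types X Y Z V W : set 'M[K]_n.

(* Polynomial functions in the n ^ 2 entries of a matrix; strictly upper
   triangular matrices form a closed linear subspace, so they inherit from here
   their usual Zariski topology. *)
Definition meval (p : {mpoly K[(n * n)%N]}) (A : 'M[K]_n) : K :=
  p.@[fun i => mxvec A 0 i].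

Definition zclosed V : Prop :=
  exists S : set {mpoly K[(n * n)%N]}, V = [set A | forall p, S p -> meval p A = 0].

Definition zclosed_in X Z : Prop := exists2 V, zclosed V & Z = X `&` V.

Definition zirreducible Z : Prop :=
  Z !=set0 /\
  forall V W, zclosed V -> zclosed W -> Z `<=` V `|` W -> Z `<=` V \/ Z `<=` W.

Definition zchain X (d : nat) (c : nat -> set 'M[K]_n) : Prop :=
  (forall i, (i <= d)%N -> zclosed_in X (c i) /\ zirreducible (c i)) /\
  (forall i, (i < d)%N -> c i `<=` c i.+1 /\ c i <> c i.+1).

(* The default value 0 of [supremum] is used when X is empty or the lengths are
   unbounded; the latter never happens, lengths being at most n ^ 2. *)
Definition zdim X : nat := supremum 0%N [set d | exists c, zchain X d c].

End Zariski.

Definition borel (K : fieldType) (n : nat) : set 'M[K]_n :=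
  [set b | b \in unitmx /\ forall i j : 'I_n, (j < i)%N -> b i j = 0]%classic.

Section Orbits.
Variables (R : realType) (n : nat).
Implicit Types s t u : 'S_n.

Definition Nmx s : 'M[R[i]]_n := \matrix_(i, j) ((i < j)%N && (s i == j))%:R.

Definition orbitB s : set 'M[R[i]]_n :=
  [set b *m Nmx s *m invmx b | b in @borel R[i] n]%classic.

(* [enum_val] lists the indices of an interval in increasing order. *)
Definition intervalmx (A : 'M[R[i]]_n) (i j : 'I_n) :=
  let I := [pred l : 'I_n | i <= l <= j]%N in
  mxsub (@enum_val _ I) (@enum_val _ I) A.

Definition rankmx s : 'M[nat]_n :=
  \matrix_(i, j) (if (i < j)%N then \rank (intervalmx (Nmx s) i j) else 0%N).

Definition leS t s : bool :=
  [forall i, forall j, (rankmx t i j <= rankmx s i j)%N].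

Definition ltS t s : bool := leS t s && (t != s).

Definition descendants (k : nat) s : {set 'S_n} :=
  [set t in S2k n k | ltS t s &&
    [forall u in S2 n, leS t u && leS u s ==> (u == s) || (u == t)]].

(* Codimension of the orbit of t in the closure of the orbit of s, when t <= s;
   an orbit and its closure have the same dimension. *)
Definition codimB s t : int := (zdim (orbitB s))%:Z - (zdim (orbitB t))%:Z.

End Orbits.

(* Main.v *)
Require Import Defs.
From HB Require Import structures.
From mathcomp Require Import all_boot all_order all_algebra all_fingroup.
From mathcomp Require Import boolp classical_sets reals.
From mathcomp Require Import complex mpoly zify ring.

(** Geometry. Order the positions of an upper triangular matrix so that every initial
    segment spans a two-sided ideal [J_m] of the algebra [T] of upper triangular matrices.
    The orbits [C_m] of [N_s] under the units of [1 + J_m] form a chain from the point [N_s]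
    to the whole orbit. Each [C_m] is closed in the orbit, because membership is solvability
    of a linear system whose rank is constant on the orbit. From [C_m] to [C_(m+1)] either
    nothing changes or [C_(m+1)] is a one-parameter family of conjugates of [C_m]; the latter
    happens exactly when the new position is not the leading position of a matrix centralizing
    [N_s]. So the dimension of the orbit is at least the number [d(s)] of such positions. It is
    at most [d(s)], because the polynomial functions of degree [<= k] on the orbit span a
    space of dimension [<= (2k+1)^d(s)], while a chain of length [d + 1] of irreducible closed
    sets forces a growth of order [k^(d + 1)].

    Combinatorics. For an adjacent transposition, "lowering" and "raising" an involution by
    conjugation act on the rank function by the lattice formulas
    [R'(i+1, q) = max (R(i+2, q), R(i, q) - 1)] and [min (R(i, q), R(i+2, q) + 1)], so they are
    monotone, and they change [d] by one. A lifting argument, as for the Bruhat order, shows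
    that below [s] and above any smaller [s'] there is an element with [d] one less than
    [d(s)]: the order is graded by [d]. *)

Set Implicit Arguments.
Unset Strict Implicit.
Unset Printing Implicit Defensive.

Import Order.TTheory GRing.Theory Num.Theory.

(** * Involutions ordered by their rank functions *)

Local Open Scope nat_scope.

Section Combinatorics.
Variable n : nat.
Implicit Types (s t : 'S_n) (p q : nat) (x : 'I_n).

Local Notation invol s := (involutive (fun x => s x)).

(* Half-open interval: arcs with both ends in [p, ..., q - 1]. *)
Definition arcs s p q : nat :=
  \sum_(x < n) [&& p <= x, x < s x & s x < q].

Definition arcs_le s t := forall p q, arcs s p q <= arcs t p q.

Lemma arcs_recl s x q :
  arcs s x q = arcs s x.+1 q + (x < s x < q).
Proof.
rewrite /arcs (bigD1 x) //= [in RHS](bigD1 x) //= leqnn ltnn /= add0n addnC.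
congr (_ + _); apply: eq_bigr => y; rewrite -val_eqE /= => yx.
by rewrite [x < y]ltn_neqAle eq_sym yx.
Qed.

Lemma arcs_recr s x p : invol s ->
  arcs s p x.+1 = arcs s p x + (p <= s x < x).
Proof.
move=> sK; rewrite /arcs (bigD1 (s x)) //= [in RHS](bigD1 (s x)) //= sK ltnSn ltnn !andbF /=.
rewrite add0n andbT addnC; congr (_ + _).
apply: eq_bigr => y yx; have : s y != x by apply: contra yx => /eqP <-; rewrite sK.
by rewrite -val_eqE /= ltnS (leq_eqVlt (s y)) => /negPf ->.
Qed.

Lemma arcs_leq_recl s p q : arcs s p q <= (arcs s p.+1 q).+1.
Proof.
case: (ltnP p n) => pn; first by rewrite (arcs_recl s (Ordinal pn)) /=; lia.
by rewrite /arcs big1 // => x _; have := ltn_ord x; lia.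
Qed.

Lemma arcs_geq_recl s p q : arcs s p.+1 q <= arcs s p q.
Proof. by apply: leq_sum => x _; lia. Qed.

Lemma arcs_leq_recr s p q : invol s -> arcs s p q.+1 <= (arcs s p q).+1.
Proof.
move=> sK; case: (ltnP q n) => qn; first by rewrite (arcs_recr (Ordinal qn)) //=; lia.
apply: leqW; apply: leq_sum => x _; have := ltn_ord (s x); lia.
Qed.

Lemma arcs_empty s p q : q <= p.+1 -> arcs s p q = 0.
Proof. by move=> qp; rewrite /arcs big1 // => x _; lia. Qed.

Lemma arcs_overl s p q : n <= p -> arcs s p q = 0.
Proof. by move=> np; rewrite /arcs big1 // => x _; have := ltn_ord x; lia. Qed.

Lemma arcs_overr s p q : n <= q -> arcs s p q = arcs s p n.
Proof. by move=> nq; apply: eq_bigr => x _; have := ltn_ord (s x); lia. Qed.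

(** By [arcs_recl], the rank function tells for all [x] and [q] whether [x] opens an arc ending
    before [q]; this determines the left ends and their partners, hence the involution. *)
Lemma eq_arcs s t : invol s -> invol t -> (forall p q, arcs s p q = arcs t p q) -> s = t.
Proof.
move=> sK tK e.
have H x : (x < s x) = (x < t x) /\ (x < s x -> s x = t x).
  have h q : (x < s x < q) = (x < t x < q).
    by have := e x q; rewrite !arcs_recl e; lia.
  split; first by have := h n; rewrite !ltn_ord; lia.
  move=> lx; apply: val_inj => /=; have := h (s x); have := h (s x).+1; have := h (t x).+1.
  lia.
apply/permP => x; have [a b] := H x.
case: (ltngtP x (s x)) => c; first by rewrite b.
  have [a' b'] := H (s x); rewrite sK in a' b'.
  by rewrite [in RHS]b' // tK.
have tx : ~~ (x < t x) by rewrite -a; lia.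
have [a' b'] := H (t x); rewrite tK in a' b'.
case: (ltngtP x (t x)) tx => // d _; last by apply: val_inj; rewrite /= -c.
have e2 : s (t x) = x by apply: b'; rewrite a'.
by rewrite -[in LHS]e2 sK.
Qed.


(* Left ends come before fixed points, which come before right ends; ties are broken by
   the partner. *)
Definition key s x : nat :=
  (if x < s x then 0 else if s x < x then n.*2 else n) + s x.

(** * Conjugation of involutions by an adjacent transposition *)

Section AdjacentSwap.
Variables (a b : 'I_n).
Hypothesis ab : b = a.+1 :> nat.

Definition swap s : 'S_n := (s ^ tperm a b)%g.
Definition desc s : bool := key s b < key s a.
(** The side conditions exclude [s a = b] and two fixed points: there the keys increase, but
    conjugation changes nothing. *)
Definition asc s : bool := [&& key s a < key s b, s a != b & (s a != a) || (s b != b)].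
Definition lower s : 'S_n := if desc s then swap s else s.
Definition raise s : 'S_n := if asc s then swap s else s.

Lemma swapE s x : swap s (tperm a b x) = tperm a b (s x).
Proof. exact: permJ. Qed.

Lemma swapEl s : swap s a = tperm a b (s b).
Proof. by rewrite -swapE tpermR. Qed.

Lemma swapEr s : swap s b = tperm a b (s a).
Proof. by rewrite -swapE tpermL. Qed.

Lemma swapK : involutive swap.
Proof. by move=> s; rewrite /swap -conjgM tperm2 conjg1. Qed.

Lemma val_tperm_adj x :
  tperm a b x = (if x == a :> nat then a.+1 else if x == b :> nat then a : nat else x) :> nat.
Proof.
case: tpermP => [->|->|xa xb]; rewrite ?eqxx -?ab //.
  by case: eqP => // e; lia.
by rewrite !val_eqE; move/eqP/negPf: xa => ->; move/eqP/negPf: xb => ->.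
Qed.

Lemma swap_invol s : invol s -> invol (swap s).
Proof.
by move=> sK x; rewrite -(tpermK a b x) swapE swapE sK.
Qed.

Lemma arc_eq s : invol s -> (s a == b) = (s b == a).
Proof. by move=> sK; apply/eqP/eqP => <-; rewrite sK. Qed.

Lemma desc_no_arc s : invol s -> desc s -> s a != b.
Proof.
move=> sK; rewrite /desc /key; apply: contraL => /eqP e.
have e2 : s b = a by rewrite -e sK.
by rewrite e e2 ab ltnSn [a.+1 < a]ltnNge leqnSn /= -leqNgt; have := ltn_ord a; have := ltn_ord b; lia.
Qed.

(** An interval contains just one of [a] and [b] only if [p = b] or [q = b]. As [(a, b)] is not an
    arc, relabelling preserves the orientation of every arc. *)
Lemma arcs_swap s p q : invol s -> s a != b -> p != b :> nat -> q != b :> nat ->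
  arcs (swap s) p q = arcs s p q.
Proof.
move=> sK nab pb qb; rewrite /arcs (reindex_inj (@perm_inj _ (tperm a b))) /=.
apply: eq_bigr => x _; rewrite swapE !val_tperm_adj.
have h1 : ~ (x = a :> nat /\ s x = b :> nat).
  by case=> /val_inj-> /val_inj e; rewrite e eqxx in nab.
have h2 : ~ (x = b :> nat /\ s x = a :> nat).
  by case=> /val_inj-> /val_inj e; rewrite arc_eq // e eqxx in nab.
by congr nat_of_bool; do ![case: eqP => ?]; lia.
Qed.

Lemma swap_local s : invol s -> s a != b ->
  [/\ s a != s b :> nat, (s b == a :> nat) = false & (s a == b :> nat) = false].
Proof.
move=> sK nab; split; last exact/negbTE.
  by rewrite val_eqE (inj_eq perm_inj) -val_eqE /=; lia.
by apply/negbTE; rewrite val_eqE -arc_eq.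
Qed.

(** After lowering, the larger key sits at [b], so [b] opens an arc ending before [q] only if both
    [a] and [b] did. The conjunction is symmetric; with [arcs_adjl] it yields the [max] formula. *)
Lemma arcs_lowerl s q : invol s -> q != b :> nat ->
  arcs (lower s) b q = arcs s b.+1 q + (a < s a < q) && (b < s b < q).
Proof.
move=> sK qb; rewrite /lower; case: ifPn => ds.
  have nab := desc_no_arc sK ds; have [h1 h2 h3] := swap_local sK nab.
  rewrite arcs_recl swapEr val_tperm_adj arcs_swap //; last by lia.
  congr (_ + _); move: ds; rewrite /desc /key ?h2 ?h3.
  move: (ltn_ord a) (ltn_ord (s a)) (ltn_ord (s b)) (ltn_ord b) => ? ? ? ?.
  by case: (ltngtP a (s a)) => ?; case: (ltngtP b (s b)) => ? ds; do ?case: ifP => ?; lia.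
rewrite arcs_recl; congr (_ + _); move: ds; rewrite /desc /key.
move: (ltn_ord a) (ltn_ord (s a)) (ltn_ord (s b)) (ltn_ord b) => ? ? ? ?.
by case: (ltngtP a (s a)) => ?; case: (ltngtP b (s b)) => ? ds; lia.
Qed.

Lemma arcs_lowerr s p : invol s -> p != b :> nat ->
  arcs (lower s) p b = arcs s p a + (p <= s a < a) && (p <= s b < b).
Proof.
move=> sK pb; rewrite /lower; case: ifPn => ds.
  have nab := desc_no_arc sK ds; have [h1 h2 h3] := swap_local sK nab.
  rewrite [in LHS]ab arcs_recr ?swapEl ?val_tperm_adj; last exact: swap_invol.
  rewrite arcs_swap //; last by lia.
  congr (_ + _); move: ds; rewrite /desc /key ?h2 ?h3.
  move: (ltn_ord a) (ltn_ord (s a)) (ltn_ord (s b)) (ltn_ord b) => ? ? ? ?.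
  by case: (ltngtP a (s a)) => ?; case: (ltngtP b (s b)) => ? ds; do ?case: ifP => ?; lia.
rewrite [in LHS]ab arcs_recr //; congr (_ + _); move: ds; rewrite /desc /key.
move: (ltn_ord a) (ltn_ord (s a)) (ltn_ord (s b)) (ltn_ord b) => ? ? ? ?.
have h1 : s a != s b :> nat by rewrite val_eqE (inj_eq perm_inj) -val_eqE /=; lia.
by case: (ltngtP a (s a)) => ?; case: (ltngtP b (s b)) => ? ds; lia.
Qed.

(** Dually, raising puts the smaller key at [b] (two fixed points contribute nothing); the
    disjunction yields the [min] formula. *)
Lemma arcs_raisel s q : invol s -> s a != b -> q != b :> nat ->
  arcs (raise s) b q = arcs s b.+1 q + ((a < s a < q) || (b < s b < q)).
Proof.
move=> sK nab qb; have [h1 h2 h3] := swap_local sK nab.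
rewrite /raise /asc nab andTb -!val_eqE /=; case: ifPn => ds.
  rewrite arcs_recl swapEr val_tperm_adj arcs_swap //; last by lia.
  congr (_ + _); move: ds; rewrite /key ?h2 ?h3.
  move: (ltn_ord a) (ltn_ord (s a)) (ltn_ord (s b)) (ltn_ord b) => ? ? ? ?.
  by case: (ltngtP a (s a)) => ?; case: (ltngtP b (s b)) => ? ds; do ?case: ifP => ?; lia.
rewrite arcs_recl; congr (_ + _); move: ds; rewrite /key.
move: (ltn_ord a) (ltn_ord (s a)) (ltn_ord (s b)) (ltn_ord b) => ? ? ? ?.
by case: (ltngtP a (s a)) => ?; case: (ltngtP b (s b)) => ? ds; lia.
Qed.

Lemma arcs_raiser s p : invol s -> s a != b -> p != b :> nat ->
  arcs (raise s) p b = arcs s p a + ((p <= s a < a) || (p <= s b < b)).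
Proof.
move=> sK nab pb; have [h1 h2 h3] := swap_local sK nab.
rewrite /raise /asc nab andTb -!val_eqE /=; case: ifPn => ds.
  rewrite [in LHS]ab arcs_recr ?swapEl ?val_tperm_adj; last exact: swap_invol.
  rewrite arcs_swap //; last by lia.
  congr (_ + _); move: ds; rewrite /key ?h2 ?h3.
  move: (ltn_ord a) (ltn_ord (s a)) (ltn_ord (s b)) (ltn_ord b) => ? ? ? ?.
  by case: (ltngtP a (s a)) => ?; case: (ltngtP b (s b)) => ? ds; do ?case: ifP => ?; lia.
rewrite [in LHS]ab arcs_recr //; congr (_ + _); move: ds; rewrite /key.
move: (ltn_ord a) (ltn_ord (s a)) (ltn_ord (s b)) (ltn_ord b) => ? ? ? ?.
by case: (ltngtP a (s a)) => ?; case: (ltngtP b (s b)) => ? ds; lia.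
Qed.

Lemma arcs_adjl s q : arcs s a q = arcs s b.+1 q + (a < s a < q) + (b < s b < q).
Proof. by rewrite arcs_recl -ab arcs_recl; lia. Qed.

Lemma arcs_adjr s p : invol s ->
  arcs s p b.+1 = arcs s p a + (p <= s a < a) + (p <= s b < b).
Proof. by move=> sK; rewrite arcs_recr // [X in arcs s p X]ab arcs_recr //; lia. Qed.

Lemma arcs_lower s p q : invol s -> p != b :> nat -> q != b :> nat ->
  arcs (lower s) p q = arcs s p q.
Proof.
move=> sK pb qb; rewrite /lower; case: ifP => // ds.
by rewrite arcs_swap // desc_no_arc.
Qed.

Lemma arcs_raise s p q : invol s -> p != b :> nat -> q != b :> nat ->
  arcs (raise s) p q = arcs s p q.
Proof.
by move=> sK pb qb; rewrite /raise /asc; case: ifP => // /and3P[_ nab _]; rewrite arcs_swap.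
Qed.

(** Where [lower] changes the rank function, the new value is a nondecreasing function of two old
    values. *)
Lemma lower_mono s t : invol s -> invol t -> arcs_le s t -> arcs_le (lower s) (lower t).
Proof.
move=> sK tK le p q; have [-> | pb] := eqVneq p b.
  have [->|qb] := eqVneq q b; first by rewrite !arcs_empty.
  rewrite !arcs_lowerl //; have := le a q; have := le b.+1 q; rewrite !arcs_adjl; lia.
have [->|qb] := eqVneq q b; last by rewrite !arcs_lower.
rewrite !arcs_lowerr //; have := le p a; have := le p b.+1; rewrite !arcs_adjr //; lia.
Qed.

Lemma raise_mono s t : invol s -> invol t -> s a != b -> t a != b ->
  arcs_le s t -> arcs_le (raise s) (raise t).
Proof.
move=> sK tK sab tab le p q; have [-> | pb] := eqVneq p b.
  have [->|qb] := eqVneq q b; first by rewrite !arcs_empty.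
  rewrite !arcs_raisel //; have := le a q; have := le b.+1 q; rewrite !arcs_adjl; lia.
have [->|qb] := eqVneq q b; last by rewrite !arcs_raise.
rewrite !arcs_raiser //; have := le p a; have := le p b.+1; rewrite !arcs_adjr //; lia.
Qed.

Lemma desc_swap s : invol s -> asc s -> desc (swap s).
Proof.
move=> sK /and3P[ds nab]; have [h1 h2 h3] := swap_local sK nab.
rewrite -!val_eqE /=; move: ds; rewrite /desc /key swapEl swapEr !val_tperm_adj ?h2 ?h3.
move: (ltn_ord a) (ltn_ord (s a)) (ltn_ord (s b)) (ltn_ord b) => ? ? ? ?.
by case: (ltngtP a (s a)) => ?; case: (ltngtP b (s b)) => ? ds ff; do ![case: ifP => ?]; lia.
Qed.

Lemma asc_swap s : invol s -> desc s -> asc (swap s).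
Proof.
move=> sK ds; have nab := desc_no_arc sK ds; have [h1 h2 h3] := swap_local sK nab.
apply/and3P; split.
- move: ds; rewrite /desc /key swapEl swapEr !val_tperm_adj ?h2 ?h3.
  move: (ltn_ord a) (ltn_ord (s a)) (ltn_ord (s b)) (ltn_ord b) => ? ? ? ?.
  by case: (ltngtP a (s a)) => ?; case: (ltngtP b (s b)) => ? ds; do ![case: ifP => ?]; lia.
- rewrite swapEl -val_eqE /= val_tperm_adj ?h2; move: h3; do ![case: ifP => ?]; lia.
- move: ds; rewrite /desc /key swapEl swapEr -!val_eqE /= !val_tperm_adj ?h2 ?h3.
  by case: (ltngtP a (s a)) => ?; case: (ltngtP b (s b)) => ? ds; do ?[case: ifP => ?]; lia.
Qed.

End AdjacentSwap.
End Combinatorics.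

(** * The statistic [orbdim] and the existence of covers *)

Section Covers.
Variable n : nat.
Implicit Types (s t u v w : 'S_n) (x y z : 'I_n).
Local Notation invol s := (involutive (fun x => s x)).

(* [(x, y)] with [x <= y] is the leading position of no upper triangular matrix commuting
   with the matrix of [s], see [leadP]. *)
Definition nonlead s x y : bool :=
  (x <= y) && ((y < s y) || (s x < x) && ~~ (s y < y) || [&& s x < x, s y < y & s y < s x]).

Definition orbdim s : nat := \sum_(p : 'I_n * 'I_n) nonlead s p.1 p.2.

Lemma tperm_adj_ltn (a b x y : 'I_n) : b = a.+1 :> nat ->
  ~~ ((x == a) && (y == b)) -> ~~ ((x == b) && (y == a)) ->
  (tperm a b x < tperm a b y) = (x < y).
Proof.
move=> ab; rewrite !(val_tperm_adj ab) -!val_eqE /=.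
by do ![case: eqP => ? /=]; lia.
Qed.

(** The involution [f] of the set of pairs, given by the transposition away from [(a, b)] and
    [(b, a)], matches the pairs counted for [s] with those counted for its swap, except for the
    single pair [p0]. *)
Lemma orbdim_swap (a b : 'I_n) s : b = a.+1 :> nat -> invol s -> desc a b s ->
  orbdim s = (orbdim (swap a b s)).+1.
Proof.
move=> ab sK ds; have nab := desc_no_arc ab sK ds.
have [h1 h2 h3] := swap_local ab sK nab.
pose t := tperm a b.
pose fixed (p : 'I_n * 'I_n) := (p == (a, b)) || (p == (b, a)).
pose f p := if fixed p then p else (t p.1, t p.2).
have fixed_t p : fixed (t p.1, t p.2) = fixed p.
  have tE z c : (t z == c) = (z == t c) by rewrite (inv_eq (tpermK a b)).
  by case: p => x y; rewrite /fixed !xpair_eqE /= !tE /t tpermL tpermR orbC.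
have fK : involutive f.
  move=> p; rewrite /f; case: (boolP (fixed p)) => pf; rewrite ?fixed_t ?pf //.
  by rewrite (negPf pf) /= !tpermK; case: p {pf}.
(* If [a] opens an arc, the descent nests the arc of [b] inside it and the swap makes the two cross:
   their right ends form the lost pair. Otherwise the lost pair is [(a, b)] itself. *)
pose p0 := if b < s a then (s b, s a) else (a, b).
have key_eq p : nonlead s p.1 p.2 = nonlead (swap a b s) (f p).1 (f p).2 + (p == p0) :> nat.
  case: p => x y /=; rewrite /f; case: ifPn => /=.
    case/orP => /eqP[-> ->]; last first.
      have -> : (b, a) == p0 = false.
        by rewrite /p0; case: ifP => ?; rewrite xpair_eqE -!val_eqE /=; apply/negbTE; lia.
      by rewrite /nonlead ab ltnn.
    have -> : (a, b) == p0 = ~~ (b < s a).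
      rewrite /p0; case: ifP => _; rewrite xpair_eqE -!val_eqE /=; last by rewrite !eqxx.
      by apply/negbTE; move: h2 h3; lia.
    move: ds; rewrite /nonlead /desc /key swapEl swapEr !(val_tperm_adj ab) ?h2 ?h3.
    move: (ltn_ord a) (ltn_ord (s a)) (ltn_ord (s b)) (ltn_ord b) => ? ? ? ?.
    by case: (ltngtP a (s a)) => ?; case: (ltngtP b (s b)) => ? ds; do ?[case: ifP => ?]; lia.
  move=> nf; rewrite /nonlead !swapE.
  have -> : ((x, y) == p0) = [&& b < s a, s x == b & s y == a].
    rewrite /p0; case: ifP => _ /=; last by apply/negbTE; case/norP: nf.
    by rewrite xpair_eqE !(inv_eq sK).
  have arc_t z : (tperm a b z < tperm a b (s z)) = (z < s z) /\
                 (tperm a b (s z) < tperm a b z) = (s z < z).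
    have hz c d : s c != d -> ~~ ((z == c) && (s z == d)).
      by move=> cd; apply/negP => /andP[/eqP-> cd']; rewrite cd' in cd.
    have nba : s b != a by rewrite -arc_eq.
    by split; apply: tperm_adj_ltn; rewrite ?hz // andbC hz.
  move: nf; rewrite /fixed !xpair_eqE negb_or => /andP[nf1 nf2].
  rewrite !(arc_t _).1 !(arc_t _).2 (leqNgt x) (leqNgt (tperm a b x)).
  have -> : (tperm a b y < tperm a b x) = (y < x) by apply: tperm_adj_ltn; rewrite 1?andbC.
  have [/andP[/eqP sx /eqP sy]|n1] := boolP ((s x == b) && (s y == a)).
    have ex : x = s b by rewrite -sx sK.
    have ey : y = s a by rewrite -sy sK.
    move: ds; rewrite sx sy tpermL tpermR ex ey andbT /desc /key.
    move: (ltn_ord a) (ltn_ord (s a)) (ltn_ord (s b)) (ltn_ord b) => ? ? ? ?.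
    by case: (ltngtP a (s a)) => ?; case: (ltngtP b (s b)) => ? ds; lia.
  rewrite andbF addn0.
  have [/andP[/eqP sx /eqP sy]|n2] := boolP ((s x == a) && (s y == b)); last first.
    by rewrite tperm_adj_ltn // andbC.
  have ex : x = s a by rewrite -sx sK.
  have ey : y = s b by rewrite -sy sK.
  move: ds; rewrite sx sy tpermL tpermR ex ey /desc /key.
  move: (ltn_ord a) (ltn_ord (s a)) (ltn_ord (s b)) (ltn_ord b) => ? ? ? ?.
  by case: (ltngtP a (s a)) => ?; case: (ltngtP b (s b)) => ? ds; lia.
rewrite /orbdim (eq_bigr _ (fun p _ => key_eq p)) big_split /= -addn1; congr (_ + _).
  by rewrite [RHS](reindex_inj (can_inj fK)).
by rewrite (bigD1 p0) //= eqxx big1 // => p /negPf ->.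
Qed.

Lemma arcs_le_trans s t u : arcs_le s t -> arcs_le t u -> arcs_le s u.
Proof. by move=> st tu p q; apply: leq_trans (tu p q). Qed.

Lemma arcs_le_anti s t : invol s -> invol t -> arcs_le s t -> arcs_le t s -> s = t.
Proof.
by move=> sK tK st ts; apply: eq_arcs => // p q; apply/eqP; rewrite eqn_leq st ts.
Qed.

Lemma lower_id (a b : 'I_n) s : ~~ desc a b s -> lower a b s = s.
Proof. by rewrite /lower => /negPf ->. Qed.

Lemma lower_le (a b : 'I_n) s : b = a.+1 :> nat -> invol s -> arcs_le (lower a b s) s.
Proof.
move=> ab sK p q; have [-> | pb] := eqVneq p b.
  have [->|qb] := eqVneq q b; first by rewrite !arcs_empty.
  by rewrite arcs_lowerl // arcs_recl; lia.
have [->|qb] := eqVneq q b; last by rewrite arcs_lower.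
by rewrite arcs_lowerr //; have := arcs_recr a p sK; rewrite -ab; lia.
Qed.

(* If no [a] is a descent, then [lower] fixes [v], and its defining recursion forces every
   positive value of the rank function of [v] to be the least possible one. *)
Lemma desc_exists u v : invol u -> invol v -> arcs u 0 n = arcs v 0 n ->
  arcs_le u v -> u != v ->
  exists a b : 'I_n, b = a.+1 :> nat /\ desc a b v.
Proof.
move=> uK vK uv le /eqP ne; apply: contrapT => nd; apply: ne.
have fixed (a b : 'I_n) : b = a.+1 :> nat -> lower a b v = v.
  by move=> ab; apply: lower_id; apply/negP => dv; apply: nd; exists a, b.
apply: arcs_le_anti => // p q.
(* Since [lower] fixes [v], if [b] opens an arc ending before [q'], so does [a]; hence a positive
   value grows by one at each enlargement of the interval. *)
have stepl i q' : 0 < arcs v i.+1 q' -> arcs v i q' = (arcs v i.+1 q').+1.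
  have [m] := ubnP (n - i); elim: m i => // m IH i im pos.
  have i1n : i.+1 < n by rewrite ltnNge; apply/negP => h; rewrite arcs_overl in pos.
  pose a := Ordinal (ltnW i1n); pose b := Ordinal i1n.
  have [qb|qb] := eqVneq q' b; first by rewrite arcs_empty ?qb in pos.
  have e := @arcs_lowerl _ a b erefl v q' vK qb; rewrite (fixed a b erefl) /= in e.
  have := @arcs_adjl _ a b erefl v q' => /= e2.
  have := IH i.+1 _; have : arcs v i.+1 q' <= (arcs v i q') by exact: arcs_geq_recl.
  have := arcs_recl v a q'; have := arcs_recl v b q' => /=; lia.
have stepr i p' : i < n -> 0 < arcs v p' i -> arcs v p' i.+1 = (arcs v p' i).+1.
  elim: i => [|i IH] i1n pos; first by rewrite arcs_empty in pos.
  pose a := Ordinal (ltnW i1n); pose b := Ordinal i1n.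
  have [qb|qb] := eqVneq p' b; first by rewrite arcs_empty // qb in pos.
  have e := @arcs_lowerr _ a b erefl v p' vK qb; rewrite (fixed a b erefl) /= in e.
  have := @arcs_adjr _ a b erefl v p' vK => /= e2.
  have := arcs_recr a p' vK; have := arcs_recr b p' vK => /=.
  have := IH (ltnW i1n); lia.
wlog qn : q / q <= n.
  case: (leqP q n) => qn; first exact.
  by move=> /(_ n (leqnn n)); rewrite !(arcs_overr _ _ (ltnW qn)).
case: (posnP (arcs v p q)) => [-> // | pos].
have ev p' : 0 < arcs v p' q -> arcs v 0 n = arcs v p' q + p' + (n - q).
  elim: p' => [|p' IH] pos'.
    rewrite addn0.
    have H m : q + m <= n -> arcs v 0 (q + m) = arcs v 0 q + m.
      by elim: m => [|m IH] qm; rewrite ?addn0 // addnS stepr ?IH; lia.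
    by have := H (n - q); rewrite (subnKC qn); apply.
  by rewrite IH stepl //; lia.
(* For any involution an enlargement adds at most one arc. As the totals agree, [v] cannot exceed
   [u] at [(p, q)]. *)
have eu : arcs u 0 n <= arcs u p q + p + (n - q).
  have h m : arcs u 0 q <= arcs u m q + m.
    by elim: m => [|m IH]; rewrite ?addn0 //; have := arcs_leq_recl u m q; lia.
  have h2 m : arcs u 0 (q + m) <= arcs u 0 q + m.
    by elim: m => [|m IH]; rewrite ?addn0 // addnS; have := arcs_leq_recr 0 (q + m) uK; lia.
  by have := h p; have := h2 (n - q); rewrite subnKC //; lia.
by have := ev _ pos; lia.
Qed.

Lemma arcs_swap_total (a b : 'I_n) s : b = a.+1 :> nat -> invol s -> s a != b ->
  arcs (swap a b s) 0 n = arcs s 0 n.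
Proof.
move=> ab sK nab; apply: arcs_swap => //; first by rewrite ab.
by rewrite neq_ltn ltn_ord orbT.
Qed.

(* Lifting argument: with [a] a descent of [v], either [u] is already below [lower v], or
   [u] has the descent as well and a cover of [lower u], [lower v] is raised. *)
Lemma lower_cover u v : invol u -> invol v -> arcs u 0 n = arcs v 0 n ->
  arcs_le u v -> u != v ->
  exists w, [/\ invol w, arcs_le u w, arcs_le w v & orbdim v = (orbdim w).+1].
Proof.
have [m] := ubnP (orbdim v); elim: m u v => // m IH u v vm uK vK uv le ne.
have [a [b [ab dv]]] := desc_exists uK vK uv le ne.
have vswap : swap a b v = lower a b v by rewrite /lower dv.
have sK := @swap_invol _ a b; have dsw := orbdim_swap ab vK dv.
have le' := lower_mono ab uK vK le; rewrite -vswap in le'.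
have v'v : arcs_le (swap a b v) v by rewrite vswap; apply: lower_le.
have [du | /lower_id eu] := boolP (desc a b u); last first.
  by rewrite eu in le'; exists (swap a b v); split => //; apply: sK.
rewrite /lower du in le'.
have [||||||w [wK uw wv wd]] := IH (swap a b u) (swap a b v); rewrite -?dsw //; try exact: sK.
- by rewrite !arcs_swap_total // (desc_no_arc ab).
- by rewrite (inj_eq (can_inj (swapK a b))).
have nau : swap a b u a != b by case/and3P: (asc_swap ab uK du).
have nav : swap a b v a != b by case/and3P: (asc_swap ab vK dv).
(* Raising [w] requires that [a] and [b] are not joined in it; this is inherited from [swap a b v],
   whose rank on that two-element interval is zero. *)
have naw : w a != b.
  have : arcs (swap a b v) a b.+1 = 0.
    rewrite arcs_recl arcs_empty // ltnS; move: nav; rewrite -val_eqE /=; lia.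
  have := wv a b.+1; rewrite (arcs_recl w); case: eqP => // ->; lia.
have rE t : invol t -> desc a b t -> raise a b (swap a b t) = t.
  by move=> tK dt; rewrite /raise asc_swap // swapK.
have := raise_mono ab (sK _ uK) wK nau naw uw; rewrite rE // => urw.
have := raise_mono ab wK (sK _ vK) naw nav wv; rewrite rE // => rwv.
(* If [raise] leaves [w] alone, then [u] is below [w], hence below [swap a b v]; otherwise
   [swap a b w] lies between [u] and [v] and has the same [orbdim] as [swap a b v]. *)
move: urw rwv; rewrite {1 2}/raise; case: ifP => aw urw rwv; last first.
  by exists (swap a b v); split; rewrite ?dsw //; [exact: sK | exact: arcs_le_trans wv].
exists (swap a b w); split=> //; first exact: sK.
by rewrite (orbdim_swap ab (sK _ wK) (desc_swap ab wK aw)) swapK -wd dsw.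
Qed.

(** Descend from [v] by [lower_cover]; the number of arcs stays constant, being squeezed between
    equal values. *)
Lemma orbdim_lt u v : invol u -> invol v -> arcs u 0 n = arcs v 0 n ->
  arcs_le u v -> u != v -> orbdim u < orbdim v.
Proof.
have [m] := ubnP (orbdim v); elim: m v => // m IH v vm uK vK uv le ne.
have [w [wK uw wv dv]] := lower_cover uK vK uv le ne; rewrite dv ltnS.
have [-> //|nuw] := eqVneq u w.
have e : arcs u 0 n = arcs w 0 n by have := uw 0 n; have := wv 0 n; lia.
by apply/ltnW/IH => //; lia.
Qed.

End Covers.

(** * Dimension of sets of matrices *)

Local Open Scope ring_scope.

(** * Polynomial functions with a degree bound, and irreducibility *)

Section PolynomialFunctions.
Variables (K : fieldType) (n : nat).
Implicit Types (f g : 'M[K]_n -> K) (k l : nat) (X Z : set 'M[K]_n).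

Inductive polyf : nat -> ('M[K]_n -> K) -> Prop :=
| polyf_const c : polyf 0 (fun=> c)
| polyf_entry i j : polyf 1 (fun A => A i j)
| polyfD k f g : polyf k f -> polyf k g -> polyf k (fun A => f A + g A)
| polyfM k l f g : polyf k f -> polyf l g -> polyf (k + l) (fun A => f A * g A)
| polyfS k f : polyf k f -> polyf k.+1 f
| polyf_ext k f g : f =1 g -> polyf k f -> polyf k g.

Definition polyfun f : Prop := exists k, polyf k f.

Lemma polyf_leq k l f : (k <= l)%N -> polyf k f -> polyf l f.
Proof.
by move=> /subnK <- fk; elim: (l - k)%N => // m IH; rewrite addSn; apply: polyfS.
Qed.

Lemma polyfZ k c f : polyf k f -> polyf k (fun A => c * f A).
Proof. by move=> fk; rewrite -[k]add0n; apply: polyfM => //; apply: polyf_const. Qed.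

Lemma polyf_sum (I : Type) (r : seq I) (P : pred I) k (F : I -> 'M[K]_n -> K) :
  (forall i, P i -> polyf k (F i)) -> polyf k (fun A => \sum_(i <- r | P i) F i A).
Proof.
move=> Fk; elim: r => [|i r IH].
  apply: (@polyf_ext _ (fun=> 0)) => [A|]; first by rewrite big_nil.
  by apply: (@polyf_leq 0) => //; apply: polyf_const.
case Pi : (P i).
  apply: (@polyf_ext _ (fun A => F i A + \sum_(j <- r | P j) F j A)).
    by move=> A; rewrite big_cons Pi.
  by apply: polyfD => //; apply: Fk.
by apply: polyf_ext IH => A; rewrite big_cons Pi.
Qed.

Lemma polyfun_const c : polyfun (fun=> c).
Proof. by exists 0; apply: polyf_const. Qed.

Lemma polyfun_entry i j : polyfun (fun A => A i j).
Proof. by exists 1; apply: polyf_entry. Qed.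

Lemma polyfunD f g : polyfun f -> polyfun g -> polyfun (fun A => f A + g A).
Proof.
move=> [k fk] [l gl]; exists (maxn k l).
by apply: polyfD; [apply: polyf_leq fk; apply: leq_maxl | apply: polyf_leq gl; apply: leq_maxr].
Qed.

Lemma polyfunM f g : polyfun f -> polyfun g -> polyfun (fun A => f A * g A).
Proof. by move=> [k fk] [l gl]; exists (k + l)%N; apply: polyfM. Qed.

Lemma polyfun_ext f g : f =1 g -> polyfun f -> polyfun g.
Proof. by move=> fg [k fk]; exists k; apply: polyf_ext fk. Qed.

Lemma polyfun_sum (I : Type) (r : seq I) (P : pred I) (F : I -> 'M[K]_n -> K) :
  (forall i, P i -> polyfun (F i)) -> polyfun (fun A => \sum_(i <- r | P i) F i A).
Proof.
move=> Fk; elim: r => [|i r IH].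
  by apply: polyfun_ext (polyfun_const 0) => A; rewrite big_nil.
case Pi : (P i); last by apply: polyfun_ext IH => A; rewrite big_cons Pi.
by apply: polyfun_ext (polyfunD (Fk i Pi) IH) => A; rewrite big_cons Pi.
Qed.

Lemma polyfun_prod (I : Type) (r : seq I) (P : pred I) (F : I -> 'M[K]_n -> K) :
  (forall i, P i -> polyfun (F i)) -> polyfun (fun A => \prod_(i <- r | P i) F i A).
Proof.
move=> Fk; elim: r => [|i r IH].
  by apply: polyfun_ext (polyfun_const 1) => A; rewrite big_nil.
case Pi : (P i); last by apply: polyfun_ext IH => A; rewrite big_cons Pi.
by apply: polyfun_ext (polyfunM (Fk i Pi) IH) => A; rewrite big_cons Pi.
Qed.

Lemma polyfun_det m (F : 'M[K]_n -> 'M[K]_m) :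
  (forall i j, polyfun (fun A => F A i j)) -> polyfun (fun A => \det (F A)).
Proof.
move=> Fij; rewrite /determinant; apply: polyfun_sum => s _.
by apply: polyfunM; [apply: polyfun_const | apply: polyfun_prod => i _; apply: Fij].
Qed.

Lemma polyfun_meval (p : {mpoly K[(n * n)%N]}) : polyfun (Defs.meval p).
Proof.
elim/mpolyind: p => [|c m p _ _ IH].
  by apply: polyfun_ext (polyfun_const 0) => A; rewrite /Defs.meval meval0.
apply: (@polyfun_ext (fun A => c * (\prod_(i < n * n) mxvec A 0 i ^+ m i) + Defs.meval p A)).
  by move=> A; rewrite /Defs.meval mevalD mevalZ mevalX.
apply: polyfunD IH; apply: polyfunM; first exact: polyfun_const.
apply: polyfun_prod => i _; case/mxvec_indexP: i => i j.
elim: (m _) => [|e IHe]; first exact: polyfun_const.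
apply: polyfun_ext (polyfunM (polyfun_entry i j) IHe) => A.
by rewrite exprS mxvecE.
Qed.

Lemma polyf_mpoly k f : polyf k f -> exists p, Defs.meval p =1 f.
Proof.
elim=> [c|i j|{}k {}f g _ [p pf] _ [q qg]|{}k l {}f g _ [p pf] _ [q qg]|//|{}k {}f g fg _ [p pf]].
- by exists c%:MP => A; rewrite /Defs.meval mevalC.
- by exists 'X_(mxvec_index i j) => A; rewrite /Defs.meval mevalXU mxvecE.
- by exists (p + q) => A; rewrite -pf -qg /Defs.meval mevalD.
- by exists (p * q) => A; rewrite -pf -qg /Defs.meval mevalM.
by exists p => A; rewrite -fg pf.
Qed.

Lemma zclosedP (V : set 'M[K]_n) : zclosed V -> forall A, ~ V A ->
  exists f, [/\ polyfun f, forall B, V B -> f B = 0 & f A != 0].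
Proof.
move=> [S ->] A /= /existsNP[p /not_implyP[Sp /eqP pA]].
by exists (Defs.meval p); split => //; [exact: polyfun_meval | move=> B; apply].
Qed.

Lemma zclosed_zeros (F : set ('M[K]_n -> K)) : (forall f, F f -> polyfun f) ->
  zclosed [set A | forall f, F f -> f A = 0]%classic.
Proof.
move=> polyF; exists [set p | F (Defs.meval p)]%classic; apply/seteqP; split=> A /= H.
  by move=> p Fp; apply: H.
move=> f Ff; have [k /polyf_mpoly[p /funext pf]] := polyF f Ff.
by rewrite -pf; apply: H; rewrite pf.
Qed.

(** The polynomial functions on [Z] have no zero divisors: for nonempty [Z], the algebraic form of
    irreducibility. *)
Definition irred Z : Prop := forall f g, polyfun f -> polyfun g ->
  (exists2 A, Z A & f A != 0) -> (exists2 A, Z A & g A != 0) ->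
  exists A, [/\ Z A, f A != 0 & g A != 0].

Lemma zirreducibleP Z : zirreducible Z <-> (exists A, Z A) /\ irred Z.
Proof.
split=> [[ne ir]|[ne ir]]; split => //.
  move=> f g pf pg [A ZA fA] [B ZB gB]; apply: contrapT => H.
  pose zero h := [set C : 'M[K]_n | forall h', (eq h) h' -> h' C = 0 :> K]%classic.
  have cl h : polyfun h -> zclosed (zero h) by move=> ph; apply: zclosed_zeros => _ <-.
  case: (ir _ _ (cl f pf) (cl g pg)) => [C ZC|sub|sub].
  - have [fC|fC] := eqVneq (f C) 0; first by left => _ <-.
    have [gC|gC] := eqVneq (g C) 0; first by right => _ <-.
    by case: H; exists C.
  - by case/eqP: fA; apply: (sub A ZA).
  - by case/eqP: gB; apply: (sub B ZB).
move=> V W cV cW sub; apply: contrapT => /not_orP[/existsNP[A /not_implyP[ZA VA]]].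
move=> /existsNP[B /not_implyP[ZB WB]].
have [f [pf f0 fA]] := zclosedP cV VA; have [g [pg g0 gB]] := zclosedP cW WB.
have [||C [ZC fC gC]] := ir f g pf pg; [by exists A | by exists B |].
by case: (sub C ZC) => [/f0|/g0] /eqP; apply/negP.
Qed.

End PolynomialFunctions.

(** * Independent functions along a chain of closed sets *)

Section ChainLength.
Variables (K : fieldType) (n : nat).
Implicit Types (f g : 'M[K]_n -> K) (k l : nat) (X Z W : set 'M[K]_n).

Definition free_on Z r (q : 'I_r -> 'M[K]_n -> K) : Prop :=
  forall c : 'rV[K]_r, (forall A, Z A -> \sum_i c 0 i * q i A = 0) -> c = 0.

(* The polynomial functions of degree at most [k] restrict to a space of dimension
   at most [m] on [Z]: the relations among any [r] of them contain a space of
   codimension at most [m]. *)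
Definition fdim_le k Z m : Prop :=
  forall r (q : 'I_r -> 'M[K]_n -> K), (forall i, polyf k (q i)) ->
  exists B : 'M[K]_(r, m), forall c : 'rV[K]_r, c *m B = 0 ->
    forall A, Z A -> \sum_i c 0 i * q i A = 0.

Lemma free_on_leq k Z m r (q : 'I_r -> 'M[K]_n -> K) :
  fdim_le k Z m -> (forall i, polyf k (q i)) -> free_on Z q -> (r <= m)%N.
Proof.
move=> dimZ qk qfree; have [B HB] := dimZ r q qk.
rewrite leqNgt; apply/negP => mr.
have : kermx B != 0.
  by rewrite -mxrank_eq0 mxrank_ker subn_eq0 -ltnNge (leq_ltn_trans (rank_leq_col B)).
apply/negP; rewrite negbK; apply/eqP/row_matrixP => i; rewrite row0.
by apply: qfree => A ZA; apply: HB => //; rewrite -row_mul mulmx_ker row0.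
Qed.

(** On [W], where [f] vanishes, a relation involves only the [p], so their coefficients are zero.
    What remains is [f] times a combination of the [q], and irreducibility of [Z] cancels [f]. *)
Lemma free_on_extend W Z f r1 r2 (p : 'I_r1 -> 'M[K]_n -> K) (q : 'I_r2 -> 'M[K]_n -> K) :
  (W `<=` Z)%classic -> irred Z -> polyfun f -> (forall A, W A -> f A = 0) ->
  (exists2 A, Z A & f A != 0) -> free_on W p -> free_on Z q -> (forall i, polyfun (q i)) ->
  free_on Z (fun i : 'I_(r1 + r2) =>
    match split i with inl a => p a | inr b => fun A => f A * q b A end).
Proof.
move=> WZ irrZ pf f0 fne pfree qfree pq c; rewrite -[c]hsubmxK.
move: (lsubmx c) (rsubmx c) => a b Hc.
have E A : \sum_i row_mx a b 0 i * (match split i with inl a => p a | inr b => fun A => f A * q b A end) A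
   = \sum_i a 0 i * p i A + f A * \sum_i b 0 i * q i A.
  rewrite big_split_ord /= mulr_sumr; congr (_ + _); apply: eq_bigr => i _.
    by rewrite row_mxEl (unsplitK (inl i)).
  by rewrite row_mxEr (unsplitK (inr i)) mulrCA.
have a0 : a = 0.
  apply: pfree => A WA; have := Hc A (WZ A WA).
  by rewrite E f0 // mul0r addr0.
suff b0 : b = 0 by rewrite a0 b0 row_mx0.
apply: qfree => A ZA; apply/eqP; apply: contrapT => /negP gA.
have [|||B [ZB fB gB]] := irrZ f (fun A => \sum_i b 0 i * q i A) pf; last 1 first.
- have := Hc B ZB; rewrite E a0 big1 ?add0r => [/eqP|i _]; last by rewrite mxE mul0r.
  by rewrite mulf_eq0 (negPf fB) (negPf gB).
- by apply: polyfun_sum => i _; apply: polyfunM => //; apply: polyfun_const.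
- by [].
by exists A.
Qed.

(** Pascal's rule: functions of degree [e * j.+1] free on [c i], and [f] times functions of degree
    [e * j] free on [c i.+1], are together free on [c i.+1]. *)
Lemma chain_free e d (c : nat -> set 'M[K]_n) :
  (forall i, (i <= d)%N -> irred (c i)) -> (exists A, c 0%N A) ->
  (forall i, (i < d)%N -> (c i `<=` c i.+1)%classic /\
     exists f, [/\ polyf e f, forall A, c i A -> f A = 0 & exists2 A, c i.+1 A & f A != 0]) ->
  forall i j, (i <= d)%N -> exists q : 'I_('C(j + i, i)) -> 'M[K]_n -> K,
    (forall a, polyf (e * j) (q a)) /\ free_on (c i) q.
Proof.
move=> irr [A0 cA0] step.
have ne i : (i <= d)%N -> c i A0.
  by elim: i => // i IH id; have [sub _] := step i id; apply/sub/IH/ltnW.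
have one i j : (i <= d)%N -> exists q : 'I_1 -> 'M[K]_n -> K,
    (forall a, polyf (e * j) (q a)) /\ free_on (c i) q.
  move=> id; exists (fun _ _ => 1); split=> [_|a Ha].
    by apply: (@polyf_leq _ _ 0) => //; apply: polyf_const.
  apply/matrixP => i0 j0; rewrite !ord1 mxE.
  by have := Ha A0 (ne i id); rewrite big_ord1 mulr1.
elim=> [|i IHi] j id; first by rewrite bin0; apply: one.
elim: j => [|j [q [qk qfree]]]; first by rewrite binn; apply: one.
have [p [pk pfree]] := IHi j.+1 (ltnW id).
have [sub [f [fe f0 fne]]] := step i id.
have -> : 'C(j.+1 + i.+1, i.+1) = ('C(j.+1 + i, i) + 'C(j + i.+1, i.+1))%N.
  by rewrite addnS binS addnC addSnnS.
have H := @free_on_extend (c i) (c i.+1) f _ _ p q sub (irr _ id) (ex_intro _ e fe) f0 fne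
  pfree qfree (fun a => ex_intro _ _ (qk a)).
exists (fun i : 'I_('C(j.+1 + i, i) + 'C(j + i.+1, i.+1)) =>
  match split i with inl a => p a | inr b => fun A => f A * q b A end); split => //.
by move=> a; case: split => b //; rewrite mulnS; apply: polyfM.
Qed.

Lemma binomial_growth d e : exists j, ((2 * (e * j)).+1 ^ d < 'C(j + d.+1, d.+1))%N.
Proof.
pose M := (d.+1`! * (2 * e).+1 ^ d)%N; exists M.
rewrite -(ltn_pmul2r (fact_gt0 d.+1)) bin_ffact.
have lo k m : (m.+1 ^ k <= (m + k) ^_ k)%N.
  elim: k => [|k IH]; first by rewrite expn0 ffactn0.
  by rewrite addnS ffactSS expnS leq_mul // ltnS leq_addr.
apply: leq_trans (lo _ _); rewrite expnS.
have mono k x y : (x <= y -> x ^ k <= y ^ k)%N by move=> xy; case: k => // k; rewrite leq_exp2r.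
have h : ((2 * (e * M)).+1 <= (2 * e).+1 * M.+1)%N by nia.
apply: (@leq_ltn_trans (((2 * e).+1 * M.+1) ^ d * d.+1`!)).
  by rewrite leq_mul2r (mono _ _ _ h) orbT.
by rewrite expnMn mulnAC (mulnC _ d.+1`!) -/M ltn_pmul2r ?expn_gt0.
Qed.

End ChainLength.

(** * Sets swept out by rational curves *)

Section OneParameterFamily.
Variables (K : numFieldType) (n : nat).
Implicit Types (f g : 'M[K]_n -> K) (k l : nat) (X Y : 'M[K]_n) (Z : set 'M[K]_n).

Lemma poly_nonroot (p : {poly K}) : p != 0 -> exists t, p.[t] != 0.
Proof.
move=> p0; apply: contrapT => H.
pose rs := [seq i%:R : K | i <- iota 0 (size p)].
have rs_root : all (root p) rs.
  by apply/allP => t _; apply: contrapT => /negP tp; apply: H; exists t.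
have rs_uniq : uniq rs.
  by rewrite map_inj_uniq ?iota_uniq // => i j /eqP; rewrite eqr_nat => /eqP.
by have := max_poly_roots p0 rs_root rs_uniq; rewrite size_map size_iota ltnn.
Qed.

Lemma size_mul3 k l (p q : {poly K}) : (size p <= (2 * k).+1)%N -> (size q <= (2 * l).+1)%N ->
  (size (p * q)%R <= (2 * (k + l)).+1)%N.
Proof. by move=> pk ql; apply: leq_trans (size_polyMleq _ _) _; lia. Qed.

Variables (D : {poly K}) (c : 'I_n -> 'I_n -> 'I_n -> 'I_n -> {poly K}).
Hypotheses (size_D : (size D <= 3)%N)
  (size_c : forall i j a b, (size (c i j a b) <= 3)%N).

(* [X] is the point with parameter [t] on the rational curve through [Y] whose entries
   have denominator [D]. *)
Definition on_curve t Y X : Prop :=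
  D.[t] != 0 /\ forall i j, D.[t] * X i j = \sum_a \sum_b (c i j a b).[t] * Y a b.

(** Up to the denominator, an entry of [X] is quadratic in [t] and linear in [Y]; so each degree of
    [f] costs two degrees in [t] and one in [Y]. *)
Lemma polyf_curve k f : polyf k f -> exists F : 'M[K]_n -> {poly K},
  [/\ forall Y, (size (F Y) <= (2 * k).+1)%N,
      forall j, polyf k (fun Y => (F Y)`_j) &
      forall t Y X, on_curve t Y X -> (F Y).[t] = D.[t] ^+ k * f X].
Proof.
elim=> [a|i j|{}k {}f g _ [F [Fs Fk Fc]] _ [G [Gs Gk Gc]]
  |{}k l {}f g _ [F [Fs Fk Fc]] _ [G [Gs Gk Gc]]|{}k {}f _ [F [Fs Fk Fc]]
  |{}k {}f g fg _ [F [Fs Fk Fc]]].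
- exists (fun=> a%:P); split=> [_|j|t _ X _]; first by rewrite size_polyC; case: (a != 0).
    exact: polyf_const.
  by rewrite hornerC mul1r.
- exists (fun Y => \sum_a \sum_b (Y a b) *: c i j a b); split=> [Y|m|t Y X [D0 ->]].
  + apply: leq_trans (size_sum _ _ _) _; apply/bigmax_leqP => a _.
    apply: leq_trans (size_sum _ _ _) _; apply/bigmax_leqP => b _.
    by exact: leq_trans (size_scale_leq _ _) _.
  + apply: (@polyf_ext _ _ _ (fun Y => \sum_a \sum_b (c i j a b)`_m * Y a b)) => [Y|].
      rewrite coef_sum; apply: eq_bigr => a _; rewrite coef_sum; apply: eq_bigr => b _.
      by rewrite coefZ mulrC.
    apply: polyf_sum => a _; apply: polyf_sum => b _; apply: polyfZ; exact: polyf_entry.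
  + rewrite horner_sum; apply: eq_bigr => a _; rewrite horner_sum; apply: eq_bigr => b _.
    by rewrite hornerZ mulrC.
- exists (fun Y => F Y + G Y); split=> [Y|j|t Y X tX].
  + by apply: leq_trans (size_polyD _ _) _; rewrite geq_max Fs Gs.
  + by apply: polyf_ext (polyfD (Fk j) (Gk j)) => Y; rewrite coefD.
  + by rewrite hornerD (Fc _ _ _ tX) (Gc _ _ _ tX) mulrDr.
- exists (fun Y => F Y * G Y); split=> [Y|j|t Y X tX].
  + exact: size_mul3.
  + apply: (@polyf_ext _ _ _ (fun Y => \sum_(a < j.+1) (F Y)`_a * (G Y)`_(j - a))) => [Y|].
      by rewrite coefM.
    by apply: polyf_sum => a _; apply: polyfM.
  + by rewrite hornerM (Fc _ _ _ tX) (Gc _ _ _ tX) exprD mulrACA.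
- exists (fun Y => D * F Y); split=> [Y|j|t Y X tX].
  + by have := @size_mul3 1 k D (F Y) size_D (Fs Y); rewrite add1n.
  + apply: (@polyf_ext _ _ _ (fun Y => \sum_(a < j.+1) D`_a * (F Y)`_(j - a))) => [Y|].
      by rewrite coefM.
    by apply: polyf_sum => a _; apply: polyfS; apply: polyfZ.
  + by rewrite hornerM (Fc _ _ _ tX) exprS mulrA.
by exists F; split=> // t Y X tX; rewrite -fg; apply: Fc.
Qed.

Variables (Z Z' : set 'M[K]_n).
Hypothesis curveP : forall X, Z' X <-> exists t, exists2 Y, Z Y & on_curve t Y X.

(** Irreducibility of [Z] gives one [Y] at which both pulled back functions are nonzero polynomials
    in the parameter; a common nonroot of these and of [D] gives the point of [Z']. *)
Lemma irred_curve : D != 0 -> (forall t Y, D.[t] != 0 -> exists X, on_curve t Y X) ->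
  irred Z -> irred Z'.
Proof.
move=> D_neq0 curve_ex irrZ f g [k fk] [l gl] [X1 /curveP[t1 [Y1 ZY1 tX1]] fX1] [X2 /curveP[t2 [Y2 ZY2 tX2]] gX2].
have polyev m (H : 'M[K]_n -> {poly K}) e t : (forall Y, size (H Y) <= e)%N ->
    (forall j, polyf m (fun Y => (H Y)`_j)) -> polyfun (fun Y => (H Y).[t]).
  move=> He Hm; exists m.
  apply: (@polyf_ext _ _ _ (fun Y => \sum_(j < e) t ^+ j * (H Y)`_j)) => [Y|].
    by rewrite (horner_coef_wide _ (He Y)); apply: eq_bigr => j _; rewrite mulrC.
  by apply: polyf_sum => j _; apply: polyfZ.
have [F [Fs Fk Fc]] := polyf_curve fk; have [G [Gs Gk Gc]] := polyf_curve gl.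
have [|||| Y [ZY FY GY]] := irrZ (fun Y => (F Y).[t1]) (fun Y => (G Y).[t2]).
- exact: polyev Fs Fk.
- exact: polyev Gs Gk.
- by exists Y1; rewrite // (Fc _ _ _ tX1) mulf_neq0 ?expf_neq0 //; case: tX1.
- by exists Y2; rewrite // (Gc _ _ _ tX2) mulf_neq0 ?expf_neq0 //; case: tX2.
have nz (p : {poly K}) t : p.[t] != 0 -> p != 0.
  by apply: contra => /eqP ->; rewrite horner0.
have [|t] := @poly_nonroot (F Y * G Y * D).
  by rewrite !mulf_neq0 // (nz _ _ FY, nz _ _ GY).
rewrite !hornerM !mulf_eq0 !negb_or => /andP[/andP[Ft Gt] Dt].
have [X tX] := curve_ex t Y Dt.
exists X; split; first by apply/curveP; exists t, Y.
  by move: Ft; rewrite (Fc _ _ _ tX) mulf_eq0 negb_or => /andP[].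
by move: Gt; rewrite (Gc _ _ _ tX) mulf_eq0 negb_or => /andP[].
Qed.

(** A combination vanishes on [Z'] once each of its [2 * k + 1] coefficients in [t] vanishes on [Z],
    which costs at most [m] linear conditions apiece. *)
Lemma fdim_le_curve k m : fdim_le k Z m -> fdim_le k Z' ((2 * k).+1 * m).
Proof.
move=> dimZ r q qk.
have /choice[F HF] := fun i => polyf_curve (qk i).
have /choice[B HB] := fun j : 'I_(2 * k).+1 =>
  dimZ r (fun i Y => (F i Y)`_j) (fun i => let: And3 _ h _ := HF i in h j).
exists (\matrix_i mxvec (\matrix_(j, l) B j i l)) => a aB X /curveP[t [Y ZY tX]].
have Dt : D.[t] ^+ k != 0 by rewrite expf_neq0 //; case: tX.
apply: (mulfI Dt); rewrite mulr0 mulr_sumr.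
transitivity (\sum_i a 0 i * (F i Y).[t]).
  by apply: eq_bigr => i _; have [_ _ Fc] := HF i; rewrite (Fc _ _ _ tX) mulrCA.
transitivity (\sum_(j < (2 * k).+1) t ^+ j * \sum_i a 0 i * (F i Y)`_j).
  under [RHS]eq_bigr => j _ do rewrite mulr_sumr.
  rewrite exchange_big; apply: eq_bigr => i _; have [Fs _ _] := HF i.
  rewrite (horner_coef_wide _ (Fs Y)) mulr_sumr; apply: eq_bigr => j _.
  by rewrite mulrA mulrC.
rewrite big1 // => j _; rewrite (HB j a) ?mulr0 //; apply/rowP => l.
have := congr1 (fun M : 'rV_(_ * m) => M 0 (mxvec_index j l)) aB.
by rewrite !mxE => e; rewrite -[RHS]e; apply: eq_bigr => i _; rewrite !mxE mxvecE mxE.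
Qed.

End OneParameterFamily.

(** * The filtration of an orbit *)

Section MinorsRank.
Variable K : fieldType.

Lemma minor_exists p q (M : 'M[K]_(p, q)) :
  exists f g, \det (mxsub f g M : 'M_(\rank M)) != 0.
Proof.
pose M1 := rowsub (maxrankfun M) M.
have full : row_full M1^T by rewrite /row_full mxrank_tr; apply: maxrowsub_free.
exists (maxrankfun M), (fullrankfun full).
rewrite -det_tr; have := mxrank_fullrowsub full.
set M2 := rowsub _ _ => rk; have -> : (mxsub (maxrankfun M) (fullrankfun full) M)^T = M2.
  by apply/matrixP => i j; rewrite !mxE.
by rewrite -unitfE -unitmxE -row_full_unit /row_full rk.
Qed.

Lemma minor_eq0 p q r (M : 'M[K]_(p, q)) (f : 'I_r -> 'I_p) (g : 'I_r -> 'I_q) :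
  (\rank M < r)%N -> \det (mxsub f g M) = 0.
Proof.
move=> Mr; apply/eqP; apply: contraTT Mr => det0; rewrite -leqNgt.
have /mxrank_unit <- : mxsub f g M \in unitmx by rewrite unitmxE unitfE.
have -> : mxsub f g M = rowsub f (M *m colsub g 1%:M).
  by rewrite mulmx_colsub mulmx1; apply/matrixP => i j; rewrite !mxE.
by apply: leq_trans (mxrankS (rowsub_sub _ _)) (mxrankM_maxl _ _).
Qed.

End MinorsRank.

(** * Upper triangular matrices and their chain of ideals *)

Section TriangularIdeals.
Variables (K : numFieldType) (n : nat).
Implicit Types (A B b g h : 'M[K]_n) (m : nat).

Definition upper A : Prop := forall i j : 'I_n, (j < i)%N -> A i j = 0.

Lemma unit_upper A : upper A -> (A \in unitmx) = [forall i, A i i != 0].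
Proof.
move=> uA; have tA : is_trig_mx A^T by apply/is_trig_mxP => i j ij; rewrite mxE uA.
rewrite unitmxE unitfE -det_tr (det_trig tA).
apply/prodf_neq0/forallP => [H i | H i _]; first by have := H i isT; rewrite mxE.
by rewrite mxE.
Qed.

Lemma upper_diag A i : upper A -> A \in unitmx -> A i i != 0.
Proof. by move=> uA; rewrite unit_upper // => /forallP. Qed.

Lemma upper_inv A : upper A -> A \in unitmx -> upper (invmx A).
Proof.
move=> uA Au i j; have [m] := ubnP (nat_of_ord j); elim: m j => // m IH j jm ji.
have := congr1 (fun M : 'M_n => M i j) (mulVmx Au); rewrite !mxE (bigD1 j) //= big1.
  rewrite addr0 (_ : (i == j) = false); last by apply/negbTE; rewrite -val_eqE /=; lia.
  by move/eqP; rewrite mulf_eq0 (negPf (upper_diag j uA Au)) orbF => /eqP.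
move=> k kj; case: (ltngtP k j) => [kj'|kj'|/val_inj e]; last by rewrite e eqxx in kj.
  by rewrite IH ?mul0r //; lia.
by rewrite uA // mulr0.
Qed.

Lemma upper_mul A B : upper A -> upper B -> upper (A *m B).
Proof.
move=> uA uB i j ji; rewrite mxE big1 // => k _.
by case: (ltnP k i) => ki; [rewrite uA // mul0r | rewrite uB ?mulr0 //; lia].
Qed.

(* The positions are numbered row by row, each row from right to left: any initial
   segment of this numbering is closed under moving up or to the right, hence spans a
   two-sided ideal of the algebra of upper triangular matrices. *)
Definition pos (i j : 'I_n) : nat := i * n + (n - j.+1).

Definition ideal m A : Prop := forall i j : 'I_n, (j < i)%N || (m <= pos i j)%N -> A i j = 0.

Lemma pos_inj i j i' j' : pos i j = pos i' j' -> i = i' /\ j = j'.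
Proof.
rewrite /pos => e; have := ltn_ord j; have := ltn_ord j' => lj' lj.
have ei : i = i' :> nat by nia.
by split; apply: val_inj => //=; move: e; rewrite ei; lia.
Qed.

Lemma pos_right (i j k : 'I_n) : (j < k)%N -> (pos i k < pos i j)%N.
Proof. by rewrite /pos => ik; have := ltn_ord k; nia. Qed.

Lemma pos_row (i j i' j' : 'I_n) : (i < i')%N -> (pos i j < pos i' j')%N.
Proof. by rewrite /pos => ik; have := ltn_ord j; nia. Qed.

Lemma pos_lt (i j : 'I_n) : (pos i j < n * n)%N.
Proof. by rewrite /pos; have := ltn_ord i; have := ltn_ord j; nia. Qed.

Lemma ideal_upper m A : ideal m A -> upper A.
Proof. by move=> mA i j ij; apply: mA; rewrite ij. Qed.

Lemma ideal_full A : ideal (n * n) A <-> upper A.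
Proof.
split=> [|uA i j /orP[/uA //|]]; first exact: ideal_upper.
by rewrite leqNgt pos_lt.
Qed.

Lemma ideal_leq m m' A : (m <= m')%N -> ideal m A -> ideal m' A.
Proof. by move=> mm mA i j ij; apply: mA; lia. Qed.

Lemma ideal0 m : ideal m 0.
Proof. by move=> i j _; rewrite mxE. Qed.

Lemma idealD m A B : ideal m A -> ideal m B -> ideal m (A + B).
Proof. by move=> mA mB i j ij; rewrite mxE mA ?mB ?addr0. Qed.

Lemma idealZ m c A : ideal m A -> ideal m (c *: A).
Proof. by move=> mA i j ij; rewrite mxE mA ?mulr0. Qed.

Lemma idealB m A B : ideal m A -> ideal m B -> ideal m (A - B).
Proof. by move=> mA mB i j ij; rewrite !mxE mA ?mB ?subr0. Qed.

Lemma ideal_mull m A B : upper B -> ideal m A -> ideal m (B *m A).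
Proof.
move=> uB mA i j ij; rewrite mxE big1 // => k _.
case: (ltnP k i) => ki; first by rewrite uB // mul0r.
rewrite mA ?mulr0 //; move: ki; rewrite leq_eqVlt => /orP[/eqP/val_inj <- // | ki].
by have := pos_row j j ki; lia.
Qed.

Lemma ideal_mulr m A B : upper B -> ideal m A -> ideal m (A *m B).
Proof.
move=> uB mA i j ij; rewrite mxE big1 // => k _.
case: (ltnP j k) => kj; first by rewrite uB // mulr0.
rewrite mA ?mul0r //; move: kj; rewrite leq_eqVlt => /orP[/eqP/val_inj -> // | kj].
by have := pos_right i kj; lia.
Qed.

Lemma ideal_lead_mull (x y : 'I_n) A B : upper B -> ideal (pos x y).+1 A ->
  (B *m A) x y = B x x * A x y.
Proof.
move=> uB mA; rewrite mxE (bigD1 x) //= big1 ?addr0 // => k kx.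
case: (ltngtP k x) => [kx'|kx'|/val_inj e]; last by rewrite e eqxx in kx.
  by rewrite uB // mul0r.
by rewrite (mA k y) ?mulr0 // pos_row ?orbT.
Qed.

Lemma ideal_lead_mulr (x y : 'I_n) A B : upper B -> ideal (pos x y).+1 A ->
  (A *m B) x y = A x y * B y y.
Proof.
move=> uB mA; rewrite mxE (bigD1 y) //= big1 ?addr0 // => k ky.
case: (ltngtP k y) => [ky'|ky'|/val_inj e]; last by rewrite e eqxx in ky.
  by rewrite (mA x k) ?mul0r // pos_right ?orbT.
by rewrite uB // mulr0.
Qed.

Lemma ideal_pred (x y : 'I_n) A : ideal (pos x y).+1 A -> A x y = 0 -> ideal (pos x y) A.
Proof.
move=> mA xy0 i j /orP[ij|]; first by rewrite mA ?ij.
rewrite leq_eqVlt => /orP[/eqP/pos_inj[<- <-] //|ij]; by rewrite mA // ij orbT.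
Qed.

Lemma ideal_delta (x y : 'I_n) : (x <= y)%N -> ideal (pos x y).+1 (delta_mx x y : 'M[K]_n).
Proof.
move=> xy i j ij; rewrite mxE; case: eqP => //= ei; case: eqP => //= ej; subst.
by move: ij; rewrite ltnn; lia.
Qed.

Lemma ideal_gap m : (forall x y : 'I_n, (x <= y)%N -> pos x y <> m) ->
  forall A, ideal m.+1 A -> ideal m A.
Proof.
move=> gap A mA i j ij; apply: mA; move: ij; case: (ltnP j i) => //= ij.
by rewrite leq_eqVlt => /orP[/eqP e|//]; case: (gap i j ij).
Qed.

Lemma upper1 : upper (1%:M : 'M[K]_n).
Proof.
by move=> i j ij; rewrite mxE (_ : (i == j) = false) //; apply/negbTE; rewrite -val_eqE /=; lia.
Qed.

Lemma upper_unipotent m h : ideal m (h - 1%:M) -> upper h.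
Proof.
move=> mh i j ij; have := mh i j; rewrite ij !mxE => /(_ isT)/eqP.
by rewrite subr_eq0 => /eqP ->; have := upper1 ij; rewrite mxE.
Qed.

End TriangularIdeals.

(** * Suborbits and the linear systems that define them *)

Section OrbitFiltration.
Variables (K : numFieldType) (n : nat) (s : 'S_n).
Hypothesis sK : involutive (fun x => s x).
Implicit Types (A B b g h X Y : 'M[K]_n) (m : nat).

Definition arcmx : 'M[K]_n := \matrix_(i, j) ((i < j)%N && (s i == j))%:R.
Local Notation N := arcmx.

Lemma mul_arcmx A i j : (A *m N) i j = if (s j < j)%N then A i (s j) else 0.
Proof.
rewrite mxE (bigD1 (s j)) //= big1 ?addr0 => [|k kj].
  by rewrite mxE sK eqxx andbT; case: ifP; rewrite ?mulr1 ?mulr0.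
by rewrite mxE (inv_eq sK) (negPf kj) andbF mulr0.
Qed.

Lemma arcmx_mul A i j : (N *m A) i j = if (i < s i)%N then A (s i) j else 0.
Proof.
rewrite mxE (bigD1 (s i)) //= big1 ?addr0 => [|k kj].
  by rewrite mxE eqxx andbT; case: ifP; rewrite ?mul1r ?mul0r.
by rewrite mxE eq_sym (negPf kj) andbF mul0r.
Qed.

Definition centralizes A : Prop := A *m N = N *m A.

(** Conjugates of [N], written without the inverse so that the equation is linear in [h] for fixed
    [X]. *)
Definition suborbit m : set 'M[K]_n :=
  [set X | exists h, [/\ ideal m (h - 1%:M), h \in unitmx & h *m N = X *m h]]%classic.

Lemma suborbit_leq m m' : (m <= m')%N -> (suborbit m `<=` suborbit m')%classic.
Proof.
by move=> mm X [h [mh hu hN]]; exists h; split=> //; apply: ideal_leq mh.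
Qed.

Lemma suborbit_arcmx m : suborbit m N.
Proof. by exists 1%:M; rewrite subrr unitmx1 mul1mx mulmx1; split=> //; apply: ideal0. Qed.

Lemma suborbit0 X : suborbit 0 X -> X = N.
Proof.
case=> h [mh _ hN]; have h1 : h = 1%:M.
  by apply/eqP; rewrite -subr_eq0; apply/eqP/matrixP => i j; rewrite mh ?orbT // mxE.
by move: hN; rewrite h1 mul1mx mulmx1.
Qed.

Lemma suborbit_full X : suborbit (n * n) X <->
  exists g, [/\ upper g, g \in unitmx & g *m N = X *m g].
Proof.
split=> [[h [/upper_unipotent]]|[g [gu gU gN]]]; first by exists h.
exists g; split=> //; apply/ideal_full => i j ij.
by rewrite !mxE gu // (_ : (i == j) = false) ?subr0 //; apply/negbTE; rewrite -val_eqE /=; lia.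
Qed.

(* Invertibility of [h] is automatic: where the diagonal of the centralizing element
   [g^-1 h] vanishes, it can be corrected within the centralizer and within the ideal. *)
Lemma suborbit_weak m h X : suborbit (n * n) X -> ideal m (h - 1%:M) ->
  h *m N = X *m h -> suborbit m X.
Proof.
case/suborbit_full => g [ug gU gN] mh hN.
have uh := upper_unipotent mh; have ugi := upper_inv ug gU.
have XE : X = g *m N *m invmx g by rewrite gN mulmxK.
pose a := invmx g *m h; have ua : upper a by apply: upper_mul.
have hE : h = g *m a by rewrite mulKVmx.
have aN : centralizes a.
  by rewrite /centralizes -mulmxA hN XE !mulmxA mulVmx // mul1mx.
move: a ua hE aN => a ua hE aN.
pose d : 'M[K]_n := diag_mx (\row_x (a x x == 0)%:R).
(* At an arc, [a N = N a] equates the diagonal entries of [a] at the two ends, so both or neither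
   are corrected. *)
have dN : centralizes d.
  rewrite /centralizes; apply/matrixP => i j; rewrite /d mul_diag_mx mul_mx_diag !mxE.
  case: andP => [[ij /eqP sij]|_]; last by rewrite mulr0 mul0r.
  have := congr1 (fun M : 'M_n => M i j) aN; rewrite mul_arcmx arcmx_mul.
  by rewrite -sij sK sij ij => ->; rewrite mulrC.
have ud : upper d.
  move=> i j ij; rewrite !mxE (_ : (i == j) = false) //; apply/negbTE.
  by rewrite -val_eqE /=; lia.
have diag_mul A B i : upper A -> upper B -> (A *m B) i i = A i i * B i i.
  move=> uA uB; rewrite mxE (bigD1 i) //= big1 ?addr0 // => k ki.
  case: (ltngtP k i) => [ki'|ki'|/val_inj e]; last by rewrite e eqxx in ki.
    by rewrite uA // mul0r.
  by rewrite uB // mulr0.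
have md : ideal m d.
  move=> i j ij; rewrite !mxE; case: (i =P j) => //= ei; subst j.
  case: eqP => //= aii; exfalso; have := mh i i ij; rewrite !mxE eqxx => /eqP; apply/negP.
  by rewrite hE diag_mul // aii mulr0 sub0r oppr_eq0 oner_eq0.
exists (h + g *m d); split.
- by rewrite addrAC; apply: idealD mh _; apply: ideal_mull.
- rewrite hE -mulmxDr unitmx_mul gU /= unit_upper; last by move=> i j ij; rewrite mxE ua ?ud ?addr0.
  apply/forallP => i; rewrite !mxE eqxx mulr1n.
  by case: (eqVneq (a i i) 0) => [->|ai]; rewrite ?add0r ?oner_eq0 ?addr0.
by rewrite mulmxDl mulmxDr hN -mulmxA dN mulmxA gN mulmxA.
Qed.

Definition ideal_proj m A : 'M[K]_n :=
  \matrix_(i, j) (if (i <= j)%N && (pos i j < m)%N then A i j else 0).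

(** For [A] in the ideal and [h = 1 + A], the equation [h N = X h] reads [linsys m X A = X - N]; the
    projection extends the map to all matrices. *)
Definition linsys m X A : 'M[K]_n := ideal_proj m A *m N - X *m ideal_proj m A.

Fact linsys_linear m X : linear (linsys m X).
Proof.
move=> c A B; rewrite /linsys.
have -> : ideal_proj m (c *: A + B) = c *: ideal_proj m A + ideal_proj m B.
  by apply/matrixP => i j; rewrite !mxE; case: ifP; rewrite ?mulr0 ?addr0.
rewrite mulmxDl mulmxDr opprD -scalemxAl -scalemxAr scalerBr.
by rewrite addrACA.
Qed.

HB.instance Definition _ m X :=
  GRing.isLinear.Build K 'M[K]_n 'M[K]_n _ (linsys m X) (linsys_linear m X).

Lemma ideal_projP m A : ideal m (ideal_proj m A).
Proof.
move=> i j ij; rewrite mxE; case: ifP => // /andP[]; move: ij; case: (ltnP j i) => /=; lia.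
Qed.

Lemma ideal_proj_id m A : ideal m A -> ideal_proj m A = A.
Proof.
move=> mA; apply/matrixP => i j; rewrite mxE; case: ifPn => // ij.
by rewrite mA //; move: ij; lia.
Qed.

Lemma rank_lin_leq (f1 f2 : {linear 'M[K]_n -> 'M[K]_n}) (u : 'M[K]_n) (phi : 'M[K]_n -> 'M[K]_n) :
  (forall A, f1 A = u *m f2 (phi A)) -> (\rank (lin_mx f1) <= \rank (lin_mx f2))%N.
Proof.
move=> f12; apply: leq_trans (mxrankM_maxl (lin_mx f2) (lin_mulmx u)).
apply/mxrankS/row_subP => i; rewrite rowE mul_rV_lin f12.
by rewrite -[u *m _]/(mulmx u _) -mul_vec_lin -mul_vec_lin -mulmxA submxMl.
Qed.

Definition linsysmx m X : 'M[K]_(n * n) := lin_mx (linsys m X).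

(* Conjugation by [g] carries the linear system at [N] to the one at [X]. *)
Lemma rank_linsys m X : suborbit (n * n) X -> \rank (linsysmx m X) = \rank (linsysmx m N).
Proof.
case/suborbit_full => g [ug gU gN]; have ugi := upper_inv ug gU.
have XE : X = g *m N *m invmx g by rewrite gN mulmxK.
apply/eqP; rewrite eqn_leq; apply/andP; split.
  apply: (@rank_lin_leq _ _ g (fun A => invmx g *m ideal_proj m A)) => A /=.
  rewrite /linsys (@ideal_proj_id _ (invmx g *m _)); last exact: ideal_mull ugi (@ideal_projP m A).
  by rewrite mulmxBr !mulmxA mulmxV // mul1mx XE.
apply: (@rank_lin_leq _ _ (invmx g) (fun A => g *m ideal_proj m A)) => A /=.
rewrite /linsys (@ideal_proj_id _ (g *m _)); last exact: ideal_mull ug (@ideal_projP m A).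
by rewrite mulmxBr !mulmxA mulVmx // mul1mx -[invmx g *m X *m g]mulmxA -gN mulKmx.
Qed.

Definition augmx m X : 'M[K]_(n * n + 1, n * n) := col_mx (linsysmx m X) (mxvec (X - N)).

Lemma suborbitP m X : suborbit (n * n) X ->
  (suborbit m X <-> (mxvec (X - N) <= linsysmx m X)%MS).
Proof.
move=> OX; split=> [[h [mh _ hN]]|/submxP[u uE]].
  apply/submxP; exists (mxvec (h - 1%:M)); rewrite mul_vec_lin /= /linsys ideal_proj_id //.
  by congr mxvec; rewrite mulmxBl mulmxBr hN mul1mx mulmx1 opprB [RHS]addrC addrA subrK.
move: uE; rewrite mul_rV_lin => /(can_inj mxvecK) /= uE.
apply: (@suborbit_weak m (1%:M + ideal_proj m (vec_mx u))) => //.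
  by rewrite addrAC subrr add0r; apply: ideal_projP.
rewrite mulmxDl mulmxDr mul1mx mulmx1; apply/eqP.
rewrite -subr_eq0 opprD addrACA; move: uE; rewrite /linsys => <-.
by rewrite addrC addrA subrK subrr.
Qed.

(** Solvability criterion by ranks, with the rank of the system taken at [N] because it is constant
    on the orbit. *)
Lemma rank_augmx m X : suborbit (n * n) X ->
  (\rank (augmx m X) <= \rank (linsysmx m N))%N <-> suborbit m X.
Proof.
move=> OX; rewrite (suborbitP m OX) -(rank_linsys m OX) /augmx -addsmxE.
split=> [le|sub]; last first.
  by rewrite (addsmx_idPl sub).
have := addsmxSl (linsysmx m X) (mxvec (X - N)).
move=> subl; have [lr eqr] := mxrank_leqif_sup subl.
apply: submx_trans (addsmxSr (linsysmx m X) _) _.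
by rewrite -eqr eqn_leq lr le.
Qed.

Lemma polyfun_augmx m i j : polyfun (fun X => augmx m X i j).
Proof.
rewrite -(splitK i) /=; case: (split i) => {}i /=; case/mxvec_indexP: j => p q.
  apply: (@polyfun_ext _ _ (fun X => (ideal_proj m (vec_mx (delta_mx 0 i)) *m N) p q
    + \sum_k (-1 * X p k) * ideal_proj m (vec_mx (delta_mx 0 i)) k q)).
    move=> X; rewrite col_mxEu /linsysmx [RHS]mxE [RHS]mxvecE [RHS]mxE; congr (_ + _).
    rewrite [RHS]mxE [X in _ = - X]mxE -sumrN; apply: eq_bigr => k _.
    by rewrite mulN1r mulNr.
  apply: polyfunD; first exact: polyfun_const.
  apply: polyfun_sum => k _; apply: polyfunM; last exact: polyfun_const.
  by apply: polyfunM; [exact: polyfun_const | exact: polyfun_entry].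
apply: (@polyfun_ext _ _ (fun X => X p q + - N p q)).
  by move=> X; rewrite col_mxEd !ord1 mxvecE !mxE.
by apply: polyfunD; [exact: polyfun_entry | exact: polyfun_const].
Qed.

(** Outside the suborbit the augmented matrix has larger rank: a minor of that size is nonzero at
    [X] and vanishes on the whole suborbit. *)
Lemma suborbit_closed m X : suborbit (n * n) X -> ~ suborbit m X ->
  exists f, [/\ polyfun f, forall Y, suborbit m Y -> f Y = 0 & f X != 0].
Proof.
move=> OX nX; have [f [g fg]] := minor_exists (augmx m X).
exists (fun Y => \det (mxsub f g (augmx m Y))); split=> //.
  apply: polyfun_det => i j; apply: polyfun_ext (polyfun_augmx m (f i) (g j)) => Y.
  by rewrite [RHS]mxE.
move=> Y [h [mh hu hN]]; apply: minor_eq0.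
have OY : suborbit (n * n) Y.
  by apply/suborbit_full; exists h; split=> //; apply: upper_unipotent mh.
apply: leq_ltn_trans (_ : _ <= \rank (linsysmx m N))%N _.
  by apply/(rank_augmx m OY); exists h.
by rewrite ltnNge; apply/negP => /(rank_augmx m OX).
Qed.

End OrbitFiltration.

(** * One step of the filtration *)

Section FiltrationSteps.
Variables (K : numFieldType) (n : nat) (s : 'S_n).
Hypothesis sK : involutive (fun x => s x).
Implicit Types (A B g h X Y : 'M[K]_n) (m : nat).
Local Notation N := (arcmx K s).
Local Notation suborbit m := (@suborbit K n s m).

Definition lead (x y : 'I_n) : Prop := exists a : 'M[K]_n,
  [/\ centralizes s a, ideal (pos x y).+1 a & a x y != 0].

Lemma suborbit_sub_full m X : suborbit m X -> suborbit (n * n) X.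
Proof.
case=> h [mh hu hN]; apply/suborbit_full; exists h; split=> //.
exact: upper_unipotent mh.
Qed.

(** If [a] centralizes [N], then [h - t h a] solves the same equation as [h]; [t] is chosen to
    cancel the entry at [(x, y)]. *)
Lemma suborbit_lead (x y : 'I_n) : lead x y ->
  suborbit (pos x y).+1 = suborbit (pos x y).
Proof.
case=> a [aN ma axy]; apply/seteqP; split=> X; last exact: suborbit_leq.
case=> h [mh hu hN]; have uh := upper_unipotent mh.
pose t := (h - 1%:M) x y / (h x x * a x y).
apply: (@suborbit_weak _ _ _ sK _ (h - t *: (h *m a))).
- by apply: (@suborbit_sub_full (pos x y).+1); exists h.
- rewrite addrAC; apply: ideal_pred.
    by apply: idealB => //; apply: idealZ; apply: ideal_mull.
  have entryBZ A B : (A - t *: B) x y = A x y - t * B x y by rewrite !mxE.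
  rewrite entryBZ (ideal_lead_mull uh ma).
  by rewrite /t divfK ?subrr // mulf_neq0 // upper_diag.
by rewrite mulmxBl mulmxBr -scalemxAl -scalemxAr hN -[h *m a *m N]mulmxA aN !mulmxA hN.
Qed.

(** Conjugate [N] by [h = 1 + E_xy]. If some [g] from the smaller ideal gave the same conjugate,
    [h^-1 (g - h)] would centralize [N] with leading position [(x, y)]. *)
Lemma suborbit_strict (x y : 'I_n) : (x <= y)%N -> ~ lead x y ->
  exists2 X, suborbit (pos x y).+1 X & ~ suborbit (pos x y) X.
Proof.
move=> xy nl; pose h : 'M[K]_n := 1%:M + delta_mx x y.
have mh : ideal (pos x y).+1 (h - 1%:M).
  by rewrite addrAC subrr add0r; apply: ideal_delta.
have uh := upper_unipotent mh.
have hu : h \in unitmx.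
  rewrite unit_upper //; apply/forallP => i; rewrite !mxE eqxx.
  by case: (_ && _); rewrite ?addr0 ?oner_eq0 // -(natrD _ 1 1) pnatr_eq0.
have uhi := upper_inv uh hu.
exists (h *m N *m invmx h); first by exists h; split=> //; rewrite mulmxKV.
case=> g [mg gu gN]; apply: nl; exists (invmx h *m (g - h)).
have mgh : ideal (pos x y).+1 (g - h).
  have -> : g - h = (g - 1%:M) - (h - 1%:M) by rewrite opprB addrA subrK.
  by apply: idealB => //; apply: ideal_leq mg.
split; last 2 first.
- exact: ideal_mull.
- rewrite (ideal_lead_mull uhi mgh) mulf_neq0 ?upper_diag ?unitmx_inv //.
  have := mg x y; rewrite leqnn orbT => /(_ isT).
  rewrite !mxE !eqxx => /eqP; rewrite subr_eq0 => /eqP ->.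
  by rewrite opprD addrA subrr sub0r oppr_eq0 oner_eq0.
rewrite /centralizes mulmxBr mulVmx // mulmxBl mulmxBr mul1mx mulmx1 -mulmxA gN.
by rewrite !mulmxA mulVmx // mul1mx.
Qed.

Section Curve.
Variables (x y : 'I_n).
Let E : 'M[K]_n := delta_mx x y.

(* [D X = (D - t E) Y (1 + t E)] says that [X = (1 + t E)^-1 Y (1 + t E)], since
   [E E = (x == y) E]. *)
Definition curve_den : {poly K} := 1 + (x == y)%:R *: 'X.

Definition curve_coef (i j a b : 'I_n) : {poly K} :=
  ((i == a)%:R *: curve_den - ((i == x) && (a == y))%:R *: 'X) *
  ((b == j)%:R%:P + ((b == x) && (j == y))%:R *: 'X).

Local Notation D := curve_den.

Lemma size_curve_den : (size D <= 2)%N.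
Proof.
apply: leq_trans (size_polyD _ _) _; rewrite size_poly1 geq_max /=.
by apply: leq_trans (size_scale_leq _ _) _; rewrite size_polyX.
Qed.

Lemma size_curve_coef (i j a b : 'I_n) : (size (curve_coef i j a b) <= 3)%N.
Proof.
apply: leq_trans (size_polyMleq _ _) _.
have h1 : (size ((i == a)%:R *: D - ((i == x) && (a == y))%:R *: 'X)%R <= 2)%N.
  apply: leq_trans (size_polyD _ _) _; rewrite size_polyN geq_max.
  by rewrite !(leq_trans (size_scale_leq _ _)) ?size_curve_den ?size_polyX.
have h2 : (size ((b == j)%:R%:P + ((b == x) && (j == y))%:R *: 'X : {poly K})%R <= 2)%N.
  apply: leq_trans (size_polyD _ _) _; rewrite geq_max.
  rewrite !(leq_trans (size_scale_leq _ _)) ?size_polyX // andbT.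
  by rewrite size_polyC; case: (_ != 0).
lia.
Qed.

Lemma horner_curve_den t : D.[t] = 1 + (x == y)%:R * t.
Proof. by rewrite /D !hornerE. Qed.

Lemma curve_den_neq0 : D != 0.
Proof.
apply/eqP => D0; have := horner_curve_den 0; rewrite D0 horner0 mulr0 addr0 => /esym/eqP.
by rewrite oner_eq0.
Qed.

Let U t : 'M[K]_n := 1%:M + t *: E.
Let V t : 'M[K]_n := D.[t]%:M - t *: E.

Lemma on_curveE t Y X :
  on_curve D curve_coef t Y X <-> D.[t] != 0 /\ D.[t] *: X = V t *m Y *m U t.
Proof.
have H i j : (V t *m Y *m U t) i j = \sum_a \sum_b (curve_coef i j a b).[t] * Y a b.
  rewrite mxE exchange_big; apply: eq_bigr => b _; rewrite mxE mulr_suml.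
  apply: eq_bigr => a _; rewrite !mxE /curve_coef hornerM !hornerE mulrAC; congr (_ * _ * _).
    by rewrite [in RHS]mulr_natl [t * _]mulrC.
  by rewrite [t * _]mulrC.
split=> -[D0 e]; split=> //; first by apply/matrixP => i j; rewrite mxE e H.
by move=> i j; rewrite -H -e mxE.
Qed.

Lemma curve_mulE : E *m E = (x == y)%:R *: E.
Proof.
by rewrite /E mul_delta_mx_cond eq_sym; case: (x == y); rewrite ?mulr1n ?mulr0n ?scale1r ?scale0r.
Qed.

Lemma curve_VU t : V t *m U t = D.[t]%:M.
Proof.
rewrite mulmxBl !mulmxDr !mulmx1 mul_scalar_mx -scalemxAl -scalemxAr curve_mulE !scalerA.
rewrite -scalerDl -addrA -scalerBl horner_curve_den (_ : _ - _ = 0) ?scale0r ?addr0 //; ring.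
Qed.

Lemma curve_UV t : D.[t] != 0 -> U t *m (D.[t]^-1 *: V t) = 1%:M.
Proof.
move=> D0; apply: mulmx1C; rewrite -scalemxAl curve_VU -scalemx1 scalerA mulVf //.
by rewrite scale1r.
Qed.

Lemma curve_ex t Y : D.[t] != 0 -> exists X, on_curve D curve_coef t Y X.
Proof.
move=> D0; exists (D.[t]^-1 *: (V t *m Y *m U t)); apply/on_curveE; split=> //.
by rewrite scalerA mulfV // scale1r.
Qed.

Hypothesis xy : (x <= y)%N.

Lemma suborbit_curve X : suborbit (pos x y).+1 X <->
  exists t, exists2 Y, suborbit (pos x y) Y & on_curve D curve_coef t Y X.
Proof.
have uE : upper E by apply: (@ideal_upper _ _ (pos x y).+1); apply: ideal_delta.
split=> [[h [mh hu hN]]|[t [Y [g [mg gu gN]] /on_curveE[D0 DX]]]].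
  have uh := upper_unipotent mh; have hyy := upper_diag y uh hu.
  (* This cancels the [(x, y)] entry of [U t *m h - 1]; when [x = y] it gives [D.[t] = 1 / h y y],
     which is nonzero. *)
  pose t := - (h - 1%:M) x y / h y y.
  have D0 : D.[t] != 0.
    rewrite horner_curve_den /t; case: (x =P y) => [->|_]; last by rewrite mul0r addr0 oner_eq0.
    rewrite mul1r !mxE eqxx opprB mulrBl mul1r divff // addrCA subrr addr0.
    by rewrite invr_eq0.
  have UV := curve_UV D0; have VU := mulmx1C UV.
  have [Uu _] := mulmx1_unit UV.
  exists t, (U t *m X *m (D.[t]^-1 *: V t)); last first.
    apply/on_curveE; split=> //; rewrite -!mulmxA VU mulmx1 mulmxA curve_VU.
    by rewrite mul_scalar_mx.
  exists (U t *m h); split; last first.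
  - by rewrite -!mulmxA [_ *: V t *m _]mulmxA VU mul1mx hN.
  - by rewrite unitmx_mul Uu hu.
  have e : U t *m h - 1%:M = (h - 1%:M) + t *: (E *m h).
    by rewrite mulmxDl mul1mx -scalemxAl addrAC.
  have mEh : ideal (pos x y).+1 (E *m h) by apply: ideal_mulr => //; apply: ideal_delta.
  rewrite e; apply: ideal_pred; first by apply: idealD => //; apply: idealZ.
  have entryDZ A B : (A + t *: B) x y = A x y + t * B x y by rewrite !mxE.
  have Exy : E x y = 1 by rewrite mxE !eqxx.
  rewrite entryDZ (ideal_lead_mulr uh (ideal_delta K xy)) Exy mul1r.
  by rewrite /t divfK // subrr.
have UV := curve_UV D0; have VU := mulmx1C UV; have [Uu Vu] := mulmx1_unit UV.
exists (D.[t]^-1 *: V t *m g); split; last first.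
- have -> : X = D.[t]^-1 *: V t *m Y *m U t.
    by rewrite -!scalemxAl -DX scalerA mulVf // scale1r.
  by rewrite -[_ *m g *m N]mulmxA gN -!mulmxA [U t *m (_ *m g)]mulmxA UV mul1mx.
- by rewrite unitmx_mul Vu.
have -> : D.[t]^-1 *: V t *m g - 1%:M = (g - 1%:M) - (t / D.[t]) *: (E *m g).
  rewrite scalerBr scale_scalar_mx mulVf // scalerA mulmxBl mul1mx -scalemxAl.
  by rewrite addrAC [_ * t]mulrC.
apply: idealB; first exact: ideal_leq mg.
apply: idealZ; apply: ideal_mulr; first exact: upper_unipotent mg.
exact: ideal_delta.
Qed.

End Curve.

(** In each case of [nonlead], one entry of [a N = N a] equates [a x y] with zero or with an entry
    of [a] that vanishes. Otherwise a centralizing matrix is explicit. *)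
Lemma leadP (x y : 'I_n) : (x <= y)%N -> lead x y <-> ~~ nonlead s x y.
Proof.
move=> xy; have zero (a : 'M[K]_n) p q : centralizes s a ->
    (if (s q < q)%N then a p (s q) else 0) = (if (p < s p)%N then a (s p) q else 0).
  by move=> aN; rewrite -(mul_arcmx sK) aN arcmx_mul.
split=> [[a [aN ma axy]]|].
  have vanish p q : (pos x y < pos p q)%N -> a p q = 0 by move=> h; rewrite ma ?h ?orbT.
  apply/negP; rewrite /nonlead xy /= => /orP[/orP[ly|/andP[rx ry]]|/and3P[rx ry nest]].
  - have := zero a x (s y) aN; rewrite sK ly => e; case/eqP: axy; rewrite e.
    by case: ifP => // lx; apply: vanish; apply: pos_row.
  - have := zero a (s x) y aN; rewrite sK rx (negPf ry) => e; by case/eqP: axy.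
  - have := zero a (s x) y aN; rewrite sK rx ry => e; case/eqP: axy; rewrite -e.
    by apply: (ideal_upper ma).
rewrite /nonlead xy /= => nl.
have [rx|nrx] := boolP (s x < x)%N; last first.
  (* Both products with [N] are zero, as [x] is not a right end and [y] not a left end. *)
  exists (delta_mx x y); split; [|exact: ideal_delta|by rewrite mxE !eqxx oner_eq0].
  apply/matrixP => p q; rewrite (mul_arcmx sK) arcmx_mul !mxE.
  transitivity (0 : K).
    case: ifP => // rq; case: (p =P x) => //= _; case: (s q =P y) => //= e.
    by move: nl; rewrite -e sK rq.
  case: ifP => // lp; case: (s p =P x) => //= e.
  by move: nrx; rewrite -e sK lp.
have [ry nest] : (s y < y)%N /\ (s x <= s y)%N by move: nl; rewrite rx /=; lia.
(* Both products with [N] equal the elementary matrix at [(s x, y)]; the second summand lies in an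
   earlier row. *)
exists (delta_mx x y + delta_mx (s x) (s y)); split.
- apply/matrixP => p q; rewrite (mul_arcmx sK) arcmx_mul !mxE.
  transitivity (((p == s x) && (q == y))%:R : K).
    rewrite (inj_eq perm_inj); case: (eqVneq q y) => [->|qy]; last first.
      rewrite !andbF addr0; case: ifP => // rq; case: (s q =P y) => [e|]; last by rewrite andbF.
      by move: ry; rewrite -e sK; move: rq; lia.
    by rewrite ry (_ : (s y == y) = false) ?andbF ?add0r //; apply/negbTE; rewrite -val_eqE /=; lia.
  rewrite (inj_eq perm_inj) (inv_eq sK); case: (eqVneq p (s x)) => [->|px]; last first.
    rewrite /= add0r; case: ifP => // lp; case: (p =P x) => //= e.
    by move: rx lp; rewrite e; lia.
  by rewrite sK rx (_ : (s x == x) = false) ?addr0 //; apply/negbTE; rewrite -val_eqE /=; lia.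
- apply: idealD; first exact: ideal_delta.
  by apply: ideal_leq (ideal_delta K nest); rewrite ltnS ltnW // pos_row.
rewrite !mxE !eqxx /= (_ : (x == s x) = false) ?addr0 ?oner_eq0 //.
by apply/negbTE; rewrite -val_eqE /=; lia.
Qed.

End FiltrationSteps.

(** * The dimension of an orbit *)

Section OrbitDimension.
Variables (K : numFieldType) (n : nat) (s : 'S_n).
Hypothesis sK : involutive (fun x => s x).
Implicit Types (A X Y : 'M[K]_n) (m : nat).
Local Notation N := (arcmx K s).
Local Notation suborbit m := (@suborbit K n s m).

Definition steps m : nat :=
  \sum_(p : 'I_n * 'I_n) (nonlead s p.1 p.2 && (pos p.1 p.2 < m))%N.

Lemma steps0 : steps 0 = 0%N.
Proof. by rewrite /steps big1 // => p _; rewrite ltn0 andbF. Qed.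

Lemma steps_full : steps (n * n) = orbdim s.
Proof. by apply: eq_bigr => p _; rewrite pos_lt andbT. Qed.

Lemma steps_pos (x y : 'I_n) : steps (pos x y).+1 = (steps (pos x y) + nonlead s x y)%N.
Proof.
rewrite /steps (bigD1 (x, y)) //= [in RHS](bigD1 (x, y)) //= ltnSn ltnn andbT andbF add0n addnC.
congr (_ + _)%N; apply: eq_bigr => -[x' y'] /= ne; congr (nat_of_bool (_ && _)).
rewrite ltnS leq_eqVlt; case: eqP => // /pos_inj[e1 e2].
by rewrite e1 e2 eqxx in ne.
Qed.

Lemma suborbit_gap m : (forall x y : 'I_n, (x <= y)%N -> pos x y <> m) ->
  suborbit m.+1 = suborbit m /\ steps m.+1 = steps m.
Proof.
move=> gap; split.
  apply/seteqP; split=> X; last exact: suborbit_leq.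
  by case=> h [mh hu hN]; exists h; split=> //; apply: ideal_gap.
apply: eq_bigr => -[x y] _ /=; rewrite /nonlead; case: (leqP x y) => //= xy.
congr (nat_of_bool (_ && _)); rewrite ltnS leq_eqVlt; by case: eqP => // e; case: (gap x y xy).
Qed.

(* Induction along the filtration: at a step either nothing changes, or the dimension
   goes up by one and the new suborbit is swept out by a one-parameter family. *)
Lemma suborbit_ind (P : nat -> set 'M[K]_n -> Prop) :
  P 0%N [set N]%classic ->
  (forall d m (x y : 'I_n), (x <= y)%N -> pos x y = m -> ~ lead K s x y ->
     P d (suborbit m) -> P d.+1 (suborbit m.+1)) ->
  forall m, P (steps m) (suborbit m).
Proof.
move=> P0 PS; elim=> [|m IH].
  rewrite steps0 (_ : suborbit 0 = [set N]%classic) //.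
  apply/seteqP; split=> X; first exact: suborbit0.
  by move=> ->; apply: suborbit_arcmx.
have [[[x y] /= [xy e]]|gap] := pselect (exists p : 'I_n * 'I_n, (p.1 <= p.2)%N /\ pos p.1 p.2 = m).
  have := steps_pos x y; rewrite e => ->; have := leadP K sK xy.
  case: (nonlead s x y) => /= leadxy; last first.
    by rewrite addn0 -e suborbit_lead ?e //; apply/leadxy.
  by rewrite addn1; apply: PS xy e _ IH => /leadxy.
have [|-> ->] := @suborbit_gap m; last by [].
by move=> x y xy e; apply: gap; exists (x, y).
Qed.

Lemma irred_suborbit m : irred (suborbit m).
Proof.
apply: (@suborbit_ind (fun _ Z => irred Z)) => [f g _ _ [A -> fA] [B -> gB]|d {}m x y xy <- _].
  by exists N.
apply: (irred_curve (leqW (size_curve_den K x y)) (@size_curve_coef K n x y)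
  (suborbit_curve s xy)); first exact: curve_den_neq0.
exact: curve_ex.
Qed.

Lemma fdim_suborbit k m : fdim_le k (suborbit m) ((2 * k).+1 ^ steps m).
Proof.
apply: (@suborbit_ind (fun d Z => fdim_le k Z ((2 * k).+1 ^ d))) => [r q qk|d {}m x y xy <- _].
  exists (\col_i q i N) => c cq A ->; have := congr1 (fun M : 'M_1 => M 0 0) cq.
  by rewrite !mxE => e; rewrite -[RHS]e; apply: eq_bigr => i _; rewrite mxE.
rewrite expnS; exact: (fdim_le_curve (leqW (size_curve_den K x y))
  (@size_curve_coef K n x y) (suborbit_curve s xy)).
Qed.

Lemma zclosed_suborbit m : zclosed_in (suborbit (n * n)) (suborbit m).
Proof.
pose F := [set f : 'M[K]_n -> K | polyfun f /\ forall Y, suborbit m Y -> f Y = 0]%classic.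
exists [set A | forall f, F f -> f A = 0]%classic; first by apply: zclosed_zeros => f [].
apply/seteqP; split=> X.
  by move=> mX; split; [exact: suborbit_sub_full mX | move=> f [_]; apply].
case=> OX /= H; apply: contrapT => nX.
by have [f [pf f0 /eqP fX]] := suborbit_closed sK OX nX; apply: fX; apply: H.
Qed.

Lemma zirreducible_suborbit m : zirreducible (suborbit m).
Proof.
by apply/zirreducibleP; split; [exists N; apply: suborbit_arcmx | apply: irred_suborbit].
Qed.

(** Only strict steps lengthen the chain, each adding the new suborbit on top. *)
Lemma suborbit_chain m :
  exists c, zchain (suborbit (n * n)) (steps m) c /\ c (steps m) = suborbit m.
Proof.
apply: (@suborbit_ind (fun d Z => exists c, zchain (suborbit (n * n)) d c /\ c d = Z)).
  exists (fun=> suborbit 0); split; last first.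
    apply/seteqP; split=> X; first exact: suborbit0.
    by move=> ->; apply: suborbit_arcmx.
  by split=> // i _; split; [exact: zclosed_suborbit | exact: zirreducible_suborbit].
move=> d {}m x y xy <- nl [c [[cc cs] cd]].
exists (fun i => if (i <= d)%N then c i else suborbit (pos x y).+1); split; last by rewrite ltnn.
split=> i; rewrite leq_eqVlt.
  case/orP => [/eqP->|id]; first rewrite ltnn.
    by split; [exact: zclosed_suborbit | exact: zirreducible_suborbit].
  by rewrite ltnS in id; rewrite id; apply: cc.
case/orP => [/eqP[->]|id]; last first.
  have id' : (i < d)%N by [].
  by rewrite (ltnW id') id'; apply: cs.
rewrite leqnn ltnn cd; split; first exact: suborbit_leq.
by have [X X1 X2] := suborbit_strict xy nl => e; apply: X2; rewrite e.
Qed.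

(** A chain of length [D + 1] would carry, by [chain_free], more independent functions of degree
    [e * j] than [fdim_suborbit] allows, for the [j] of [binomial_growth]. *)
Lemma zchain_suborbit d c : zchain (suborbit (n * n)) d c -> (d <= orbdim s)%N.
Proof.
case=> cc cs; rewrite leqNgt; apply/negP => dlt; set O := suborbit _ in cc.
pose D := orbdim s; have {}cc i : (i <= D.+1)%N -> zclosed_in O (c i) /\ zirreducible (c i).
  by move=> iD; apply: cc; apply: leq_trans iD dlt.
have {}cs i : (i < D.+1)%N -> (c i `<=` c i.+1)%classic /\ c i <> c i.+1.
  by move=> iD; apply: cs; apply: leq_trans iD dlt.
have sub_O i : (i <= D.+1)%N -> (c i `<=` O)%classic.
  by move=> iD; have [[V _ ->] _] := cc i iD => A [].
(* As [c i] is closed in the orbit, some polynomial function vanishes on it but not on [c i.+1]. *)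
have sep (i : 'I_D.+1) : exists ef : nat * ('M[K]_n -> K), [/\ polyf ef.1 ef.2,
    forall A, c i A -> ef.2 A = 0 & exists2 A, c i.+1 A & ef.2 A != 0].
  have [sub ne] := cs i (ltn_ord i); have [[V cV ciE] _] := cc i (ltnW (ltn_ord i)).
  have /existsNP[A /not_implyP[cA nA]] : ~ (c i.+1 `<=` c i)%classic.
    by move=> sub'; apply: ne; apply/seteqP; split.
  have nV : ~ V A by move=> VA; apply: nA; rewrite ciE; split=> //; apply: sub_O cA.
  have [f [[e fe] f0 fA]] := zclosedP cV nV.
  exists (e, f); split=> //=; last by exists A.
  by move=> B; rewrite ciE => -[_ /f0].
have {sep} [F HF] := choice sep.
pose e := (\max_i (F i).1)%N.
have [j jlt] := binomial_growth D e.
have [||i iD|q [qk qfree]] := @chain_free K n e D.+1 c _ _ _ D.+1 j (leqnn _).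
- by move=> i iD; have [_ /zirreducibleP[]] := cc i iD.
- by have [_ [ne _]] := cc 0%N isT.
- split; first by case: (cs i iD).
  have [fe f0 fA] := HF (Ordinal iD); exists (F (Ordinal iD)).2; split=> //.
  by apply: polyf_leq fe; apply: leq_bigmax.
have dimO : fdim_le (e * j) (c D.+1) ((2 * (e * j)).+1 ^ D).
  move=> r q' qk'; have := @fdim_suborbit (e * j) (n * n) r q' qk'.
  rewrite steps_full => -[B HB]; exists B => a aB A cA.
  by apply: HB => //; apply: sub_O cA.
by have := free_on_leq dimO qk qfree; rewrite leqNgt jlt.
Qed.

Lemma zdim_suborbit : zdim (suborbit (n * n)) = orbdim s.
Proof.
rewrite /zdim; set S := [set d | _]%classic.
have Sd : S (orbdim s) by have [c [cc _]] := suborbit_chain (n * n); exists c; rewrite -steps_full.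
have ub : ubound S (orbdim s) by move=> d [c cc]; apply: zchain_suborbit cc.
rewrite /supremum; case: eqP => [S0|_]; first by move: Sd; rewrite S0.
apply: xget_subset1; last exact: is_subset1_supremums.
by split=> // z; apply.
Qed.

End OrbitDimension.

(** * Rank matrices and orbits of involutions *)

Section Bridge.
Variables (R : realType) (n : nat).
Implicit Types (s t u : 'S_n) (x y : 'I_n).
Local Notation invol s := (involutive (fun x => s x)).

Lemma S2P s : reflect (invol s) (s \in S2 n).
Proof.
rewrite inE; apply: (iffP eqP) => [ss1 x | sK].
  by have := permM s s x; rewrite ss1 perm1.
by apply/permP => x; rewrite permM perm1 sK.
Qed.

Lemma porbit_invol s x : invol s -> porbit s x = [set x; s x].
Proof.
move=> sK; apply/setP => y; rewrite !inE; apply/idP/orP.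
  case/porbitP => i ->; elim: i => [|i IH]; first by left; rewrite expg0 perm1.
  rewrite expgSr permM; case: IH => /eqP ->; [right | left; rewrite sK]; exact: eqxx.
by case=> /eqP ->; [exact: porbit_id | rewrite -[s x]/((s ^+ 1)%g x) mem_porbit].
Qed.

Lemma card_porbits2 s : invol s ->
  #|[set c in porbits s | #|c| == 2%N]%SET| = arcs s 0 n.
Proof.
move=> sK.
have -> : arcs s 0 n = #|[set x : 'I_n | (x < s x)%N]%SET|.
  rewrite -sum1dep_card /arcs [RHS]big_mkcond /=; apply: eq_bigr => x _.
  by rewrite ltn_ord andbT; case: (_ < _)%N.
have -> : [set c in porbits s | #|c| == 2%N]%SET = [set porbit s x | x in [set x : 'I_n | (x < s x)%N]%SET].
  apply/setP => c; apply/setIdP/imsetP => [[/imsetP[x _ ->]]|[x]].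
    rewrite porbit_invol // cards2; case: (ltngtP x (s x)) => [lx _|lx _|/val_inj <-].
    - by exists x; rewrite ?inE // porbit_invol.
    - by exists (s x); rewrite ?inE ?sK // porbit_invol // sK finset.setUC.
    - by rewrite eqxx.
  rewrite inE => lx ->; split; first exact: imset_f.
  by rewrite porbit_invol // cards2 -val_eqE /= neq_ltn lx.
rewrite card_in_imset // => x y; rewrite !inE => lx ly.
rewrite !porbit_invol // => /setP/(_ x); rewrite !inE eqxx /= => /esym/orP[/eqP //|/eqP e].
by move: lx ly; rewrite e sK; lia.
Qed.

Lemma S2kP k s : s \in S2k n k -> invol s /\ arcs s 0 n = k.
Proof.
by rewrite inE => /andP[/S2P sK]; rewrite card_porbits2 // => /eqP.
Qed.

(** Factoring through the set of arcs in the interval bounds the rank from above; rows at left ends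
    and columns at right ends give an identity minor of that size. *)
Lemma rank_intervalmx s (i j : 'I_n) : invol s ->
  \rank (intervalmx (Nmx R s) i j) = arcs s i j.+1.
Proof.
move=> sK; rewrite /intervalmx; set I := (X in @enum_val _ X).
pose P := [set x : 'I_n | [&& (i <= x)%N, (x < s x)%N & (s x < j.+1)%N]]%SET.
have -> : arcs s i j.+1 = #|P|.
  rewrite -sum1dep_card /arcs [RHS]big_mkcond /=; apply: eq_bigr => x _.
  by case: (_ && _).
have lift (v : 'I_#|P| -> 'I_n) : (forall k, v k \in I) ->
    exists f : 'I_#|P| -> 'I_#|I|, forall k, enum_val (f k) = v k.
  move=> vI; have /choice[f fE] : forall k, exists a : 'I_#|I|, enum_val a = v k.
    by move=> k; exists (enum_rank_in (vI k) (v k)); rewrite enum_rankK_in.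
  by exists f.
have PI (k : 'I_#|P|) : let x := enum_val k in [/\ x \in I, s x \in I & (x < s x)%N].
  have := enum_valP k; rewrite inE => /and3P[ix xs sj] /=; rewrite !inE.
  by split=> //; lia.
have [f fE] := lift (fun k => enum_val k) (fun k => let: And3 a _ _ := PI k in a).
have [g gE] := lift (fun k => s (enum_val k)) (fun k => let: And3 _ b _ := PI k in b).
set M := mxsub _ _ _; apply/eqP; rewrite eqn_leq; apply/andP; split.
  have -> : M = (\matrix_(a < #|I|, k < #|P|) (enum_val a == enum_val k)%:R) *m
                (\matrix_(k < #|P|, b < #|I|) (s (enum_val k) == enum_val b)%:R).
    apply/matrixP => a b; rewrite !mxE.
    have [aP|aP] := boolP (enum_val a \in P).
      rewrite (bigD1 (enum_rank_in aP (enum_val a))) //= !mxE !enum_rankK_in // eqxx mul1r.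
      rewrite big1 ?addr0 => [|k ka].
        case: eqP => [<-|]; last by rewrite andbF.
        by move: aP; rewrite inE => /and3P[_ -> _].
      rewrite !mxE; case: eqP => [e|]; last by rewrite mul0r.
      by move: ka; rewrite -(inj_eq enum_val_inj) enum_rankK_in // e eqxx.
    rewrite big1 => [|k _]; last first.
      rewrite !mxE; case: eqP => [e|]; last by rewrite mul0r.
      by move: aP; rewrite e enum_valP.
    case: andP => // -[ab /eqP e]; case/negP: aP; rewrite inE e ab /=.
    by have := enum_valP a; have := enum_valP b; rewrite !inE ltnS => /andP[_ ->] /andP[->].
  by apply: leq_trans (mxrankM_maxl _ _) (rank_leq_col _).
rewrite leqNgt; apply/negP => rM; have := minor_eq0 f g rM.
have -> : mxsub f g M = 1%:M.
  apply/matrixP => k l; rewrite !mxE fE gE (inj_eq perm_inj) (inj_eq enum_val_inj).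
  case: eqP => [<-|_]; last by rewrite andbF.
  by case: (PI k) => _ _ ->.
by rewrite det1 => /eqP; rewrite oner_eq0.
Qed.

(** Closed intervals of indices are the half-open ones with [q = j + 1]; other arguments give zero
    or reduce to [q = n]. *)
Lemma leSP s t : invol s -> invol t -> reflect (arcs_le s t) (leS R s t).
Proof.
move=> sK tK; apply: (iffP 'forall_forallP) => [H p q|le i j]; last first.
  by rewrite !mxE; case: ifP => // _; rewrite !rank_intervalmx.
wlog qn : q / (q <= n)%N.
  by case: (leqP q n) => [/[swap]|qn /(_ n (leqnn n))]; [exact | rewrite !(arcs_overr _ _ (ltnW qn))].
case: (ltnP p n) => pn; last by rewrite arcs_overl.
case: q qn => [|q] qn; first by rewrite arcs_empty.
have := H (Ordinal pn) (Ordinal qn); rewrite !mxE !rank_intervalmx //=.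
by case: ifP => // pq _; rewrite !arcs_empty; lia.
Qed.

Lemma orbitBE s : @orbitB R n s = @suborbit R[i] n s (n * n).
Proof.
apply/seteqP; split=> X.
  case=> b [bu ub] <-; apply/suborbit_full; exists b; split=> //.
  by rewrite mulmxKV.
case/suborbit_full => g [ug gu gN]; exists g; first by split.
by rewrite -[Nmx R s]/(@arcmx R[i] n s) gN mulmxK.
Qed.

Lemma zdim_orbitB s : invol s -> zdim (@orbitB R n s) = orbdim s.
Proof. by move=> sK; rewrite orbitBE zdim_suborbit. Qed.

End Bridge.

Theorem theorem3p5 (R : realType) (n k : nat) (hn : (1 <= n)%N)
    (hk : (k.*2 <= n)%N) (s s' : 'S_n)
    (hs : s \in S2k n k) (hs' : s' \in S2k n k) (hlt : ltS R s' s) :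
  codimB R s s' = 1%R <-> s' \in descendants R k s.
Proof.
have [sK sk] := S2kP hs; have [s'K s'k] := S2kP hs'.
have e0 : arcs s' 0 n = arcs s 0 n by rewrite sk s'k.
have [/(leSP R s'K sK) le ne] := andP hlt.
rewrite /codimB !zdim_orbitB //; split=> [cod | ].
  rewrite inE hs' hlt /=; apply/forall_inP => u /S2P uK; apply/implyP.
  case/andP => /(leSP R s'K uK) su /(leSP R uK sK) us.
  have eu : arcs u 0 n = arcs s 0 n by have := su 0%N n; have := us 0%N n; lia.
  have [//|nus] := eqVneq u s; have [//|nus'] := eqVneq u s'.
  (* An element strictly between would have its [orbdim] strictly between consecutive integers. *)
  have h1 : (orbdim u < orbdim s)%N by apply: orbdim_lt.
  have h2 : (orbdim s' < orbdim u)%N by apply: orbdim_lt; rewrite ?e0 // eq_sym.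
  by move: cod; lia.
rewrite inE => /and3P[_ _ /forall_inP cov].
(* The element of [orbdim] one less, between [s'] and [s], must be [s'] because [s'] is a
   descendant. *)
have [w [wK sw ws dw]] := lower_cover s'K sK e0 le ne.
have nws : w != s by apply/eqP => ws'; move: dw; rewrite ws'; lia.
have := cov w (introT (S2P w) wK).
rewrite (introT (leSP R s'K wK) sw) (introT (leSP R wK sK) ws) (negPf nws) /= => /eqP <-.
by rewrite dw; lia.
Qed.
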